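(* Let $n>1$. Game II.3 (the no-information, non-symmetric, constant-sum Showcase Showdown game with unlimited spins) with $n$ players admits a Nash equilibrium in which the player with advantage uses the threshold $\delta_n$ and all the remaining players use the same threshold $\epsilon_n$. Moreover, the winning probability of the player with advantage in this equilibrium is $$P_n^A=\left(1-e^{\epsilon_n}+e^{\epsilon_n}\epsilon_n\right)^{n-1}\left(1-e^{\delta_n}+e^{\delta_n}\delta_n\right)+\frac{e^{\delta_n}\left(1-\left(1+e^{\epsilon_n}(-1+\delta_n)\right)^n\right)}{e^{\epsilon_n}\,n}.$$
   Context: Score of a player using a greed threshold: let $Z_1,Z_2,\dots$ be independent random variables uniformly distributed on $[0,1]$ and $\chi_k=Z_1+\dots+Z_k$. For $\tau\in[0,1]$ let $N=\min\{k\ge1:\chi_k\ge\tau\}$. The score $\xi_\tau$ is $\chi_N$ if $\chi_N\le1$ and $0$ if $\chi_N>1$. Game II.3: there are $n$ players. Player $i$ chooses a threshold $\kappa_i\in[0,1]$ with no information about the other players' scores, and obtains the score $\xi^{(i)}_{\kappa_i}$, where the scores of different players are independent and $\xi^{(i)}_{\kappa_i}$ is distributed as $\xi_{\kappa_i}$. The winner is the player with the greatest score, except that if all scores are $0$ the winner is a fixed, known player, the player with advantage (say, player $n$). The game is constant-sum and each player's payoff may be taken to be $1$ if he wins and $0$ otherwise, so that his expected payoff is his winning probability. A Nash equilibrium is a profile $(\kappa_1,\dots,\kappa_n)$ such that no player can increase his expected payoff by unilaterally changing his own threshold. For each integer $n>1$, $(\epsilon_n,\delta_n)\in[0,1]\times[0,1]$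 denotes the solution $(x,y)=(\epsilon_n,\delta_n)$ with $\delta_n>\epsilon_n$ of the system $$\begin{cases}\left(1+e^{x}(-1+x)\right)^{n-2}=\dfrac{e^{y}\left(-1+\left(1+e^{x}(-1+y)\right)^n\right)+n\,e^{x}}{n\,e^{x}\left(1+e^{y}(-1+y)\right)\left(1+e^{x}(-2+n+x)\right)},\\[1.2em] \left(1+e^{x}(-1+x)\right)^{n-1}=\dfrac{e^{-x}\left(n\,e^{x}\left(1+e^{x}(y-1)\right)^{n-1}+\left(1+e^{x}(y-1)\right)^n-1\right)}{n\,y}.\end{cases}$$ *)

(* Defs.v *)
From HB Require Import structures.
From mathcomp Require Import all_boot all_order all_algebra.
From mathcomp Require Import all_classical all_reals all_analysis.

Set Implicit Arguments.
Unset Strict Implicit.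
Unset Printing Implicit Defensive.

Import Order.TTheory GRing.Theory Num.Theory.
Import numFieldNormedType.Exports.

Local Open Scope classical_set_scope.
Local Open Scope ring_scope.

(* The product rule over every finite subfamily, enumerated by a sequence
   without repetition. *)
Definition mutually_independent (d : measure_display) (T : measurableType d)
    (R : realType) (P : probability T R) (I : eqType)
    (X : I -> {RV P >-> R}) : Prop :=
  forall (s : seq I) (B : I -> set R), uniq s ->
    (forall i, measurable (B i)) ->
    P (\bigcap_(i in [set` s]) (X i @^-1` B i)) =
    (\prod_(i <- s) P (X i @^-1` B i))%E.

Definition uniform01 (d : measure_display) (T : measurableType d)
    (R : realType) (P : probability T R) (X : {RV P >-> R}) : Prop :=
  forall B : set R, measurable B ->
    P (X @^-1` B) = uniform_prob (@ltr01 R) B.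

(* [z k] is the outcome of spin number [k + 1], and [series z k] is the sum of
   the first [k] spins. *)
Definition reached (R : realType) (tau : R) (z : nat -> R) (k : nat) : bool :=
  (0 < k)%N && (tau <= series z k).

(* If the threshold is never reached, which for i.i.d. uniform spins has
   probability zero, the score is set to 0. *)
Definition score (R : realType) (tau : R) (z : nat -> R) : R :=
  if pselect (exists k, reached tau z k) is left h then
    let chi := series z (ex_minn h) in
    if chi <= 1 then chi else 0
  else 0.

Definition distributed_as_score (d d' : measure_display)
    (T : measurableType d) (T' : measurableType d') (R : realType)
    (P : probability T R) (Z : nat -> {RV P >-> R}) (tau : R)
    (P' : probability T' R) (X : {RV P' >-> R}) : Prop :=
  forall B : set R, measurable B ->
    P' (X @^-1` B) = P [set w | B (score tau (fun k => Z k w))].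

(* The winner is the player whose score beats all the others, and [adv] if all
   scores are 0.  Nobody wins when two players tie at a positive greatest
   score; in the game this event has probability zero. *)
Definition wins (R : realType) (n : nat) (adv : 'I_n) (s : 'I_n -> R)
    (i : 'I_n) : bool :=
  [forall j, (j != i) ==> (s j < s i)] ||
  ((i == adv) && [forall j, s j == 0]).

Definition payoff (R : realType) (n : nat) (adv : 'I_n) (s : 'I_n -> R)
    (i : 'I_n) : R := (wins adv s i)%:R.

(* In the game below, [S i tau] is the score that player [i] obtains with the
   threshold [tau], and [kappa] is a profile of thresholds. *)
Definition expected_payoff (d : measure_display) (T : measurableType d)
    (R : realType) (P : probability T R) (n : nat)
    (S : 'I_n -> R -> {RV P >-> R}) (adv : 'I_n)
    (kappa : 'I_n -> R) (i : 'I_n) : \bar R :=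
  ('E_P[fun w => payoff adv (fun j => S j (kappa j) w) i])%E.

Definition winning_probability (d : measure_display) (T : measurableType d)
    (R : realType) (P : probability T R) (n : nat)
    (S : 'I_n -> R -> {RV P >-> R}) (adv : 'I_n)
    (kappa : 'I_n -> R) (i : 'I_n) : \bar R :=
  P [set w | wins adv (fun j => S j (kappa j) w) i].

Definition threshold (R : realType) : set R := `[0, 1]%classic.

Definition is_game_scores (d d' : measure_display)
    (T : measurableType d) (T' : measurableType d') (R : realType)
    (P : probability T R) (Z : nat -> {RV P >-> R})
    (P' : probability T' R) (n : nat) (S : 'I_n -> R -> {RV P' >-> R}) : Prop :=
  (forall (i : 'I_n) (tau : R), threshold tau ->
     distributed_as_score Z tau (S i tau)) /\
  (forall kappa : 'I_n -> R, (forall i, threshold (kappa i)) ->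
     mutually_independent (fun i => S i (kappa i))).

Definition deviation (R : realType) (n : nat) (kappa : 'I_n -> R) (i : 'I_n)
    (tau : R) : 'I_n -> R :=
  fun j => if j == i then tau else kappa j.

Definition nash_equilibrium (R : realType) (n : nat) (A : set R)
    (u : ('I_n -> R) -> 'I_n -> \bar R) (kappa : 'I_n -> R) : Prop :=
  (forall i, A (kappa i)) /\
  (forall i tau, A tau -> (u (deviation kappa i tau) i <= u kappa i)%E).

Definition threshold_system (R : realType) (n : nat) (x y : R) : Prop :=
  (1 + expR x * (-1 + x)) ^+ (n - 2) =
    (expR y * (-1 + (1 + expR x * (-1 + y)) ^+ n) + n%:R * expR x) /
    (n%:R * expR x * (1 + expR y * (-1 + y)) *
       (1 + expR x * (-2 + n%:R + x)))
  /\
  (1 + expR x * (-1 + x)) ^+ (n - 1) =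
    expR (- x) * (n%:R * expR x * (1 + expR x * (y - 1)) ^+ (n - 1)
                  + (1 + expR x * (y - 1)) ^+ n - 1) /
    (n%:R * y).

(* (eps, delta) = (eps_n, delta_n). *)
Definition equilibrium_thresholds (R : realType) (n : nat) (eps delta : R) :
    Prop :=
  [/\ threshold eps, threshold delta, eps < delta &
      threshold_system n eps delta].

Definition advantage_profile (R : realType) (n : nat) (adv : 'I_n)
    (eps delta : R) : 'I_n -> R :=
  fun i => if i == adv then delta else eps.

(* Main.v *)
(* Before reaching the threshold the sums of the spins have the law
   P(chi_m < t) = t^m / m!, and by translation invariance every step lands in a
   set B of [tau, 1] with conditional probability |B|.  Summing over m, the
   score has density e^tau on [tau, 1] and an atom 1 - e^tau (1 - tau) at 0.

   Against opponents whose maximal score has distribution function G, the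
   threshold t wins with probability e^t times the integral of G over [t, 1]
   (plus, for the player with advantage, the probability that all scores are
   0, which amounts to replacing G by G - G(0)).  As G is nondecreasing, a
   stationary point of this function is a global maximum: the tail integral J
   satisfies J(t) <= J(s) (1 + s - t) <= J(s) e^(s - t).  The two equations of
   the system are exactly the two stationarity conditions.

   For the existence, the second equation has, for each x < 1, a unique root y
   in ]x, 1[, which depends continuously on x and tends to 1 as x does; the
   first equation along this curve is then solved by the intermediate value
   theorem. *)

Require Import Defs.
From HB Require Import structures.
From mathcomp Require Import all_boot all_order all_algebra.
From mathcomp Require Import all_classical all_reals all_analysis.
From mathcomp Require Import measurable_realfun ring lra.
Import Order.TTheory GRing.Theory Num.Theory.
Import numFieldNormedType.Exports.
Local Open Scope classical_set_scope.
Local Open Scope ring_scope.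

Set Implicit Arguments.
Unset Strict Implicit.
Unset Printing Implicit Defensive.

(** * Independence *)

(** In [D], both sides are finite measures that agree on measurable rectangles, and these form a
    generating class stable under intersection. The spare event [E] makes it possible to carry the
    remaining variables through an induction. *)
Lemma joint_law_indep (d : measure_display) (T : measurableType d)
    (R : realType) (P : probability T R) (X Y : {RV P >-> R}) (E : set T) :
  measurable E ->
  (forall A B : set R, measurable A -> measurable B ->
     P (X @^-1` A `&` (Y @^-1` B `&` E)) =
     (P (X @^-1` A) * (P (Y @^-1` B) * P E))%E) ->
  forall D : set (R * R), measurable D ->
    P ((fun w => (X w, Y w)) @^-1` D `&` E) =
    ((distribution P X \x distribution P Y) D * P E)%E.
Proof.
move=> mE indXY D mD.
have mXY : measurable_fun setT (fun w => (X w, Y w)).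
  exact/measurable_fun_pair.
have PE0 : 0 <= fine (P E) by exact: fine_ge0.
pose PE : {measure set T -> \bar R} := mrestr P mE.
pose XYE_ : {measure set (R * R) -> \bar R} :=
  pushforward PE (fun w => (X w, Y w)).
pose XYE := XYE_ mXY.
pose prodE : {measure set (R * R) -> \bar R} :=
  mscale (NngNum PE0) (distribution P X \x distribution P Y)%E.
have -> : P ((fun w => (X w, Y w)) @^-1` D `&` E) = XYE D by [].
have -> : ((distribution P X \x distribution P Y) D * P E = prodE D)%E.
  by rewrite /prodE /= /mscale /= fineK ?fin_num_measure// muleC.
pose G : set (set (R * R)) :=
  [set A `*` B | A in measurable & B in measurable].
apply: (measure_unique G (fun=> setT)) => //.
- exact: measurable_prod_measurableType.
- move=> _ _ [A1 mA1 [B1 mB1 <-]] [A2 mA2 [B2 mB2 <-]].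
  rewrite -setXI; exists (A1 `&` A2); first exact: measurableI.
  by exists (B1 `&` B2) => //; exact: measurableI.
- by move=> _; exists setT => //; exists setT => //; rewrite setXTT.
- by rewrite bigcup_const.
- move=> _ [A mA [B mB <-]].
  rewrite /prodE /= /mscale /= product_measure1E//= fineK ?fin_num_measure//.
  rewrite /XYE /XYE_ /= /pushforward /PE /= /mrestr /=.
  rewrite (_ : _ `&` E = X @^-1` A `&` (Y @^-1` B `&` E)); last first.
    by rewrite setIA.
  by rewrite indXY// /distribution /pushforward muleA muleC.
- move=> _; rewrite /XYE /XYE_ /= /pushforward /PE /= /mrestr /=.
  apply: (@le_lt_trans _ _ 1%E); last exact: ltry.
  apply: probability_le1.
  by apply: measurableI => //; rewrite -[X in measurable X]setTI; exact: (mXY).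
Qed.
(** Induction on [s]. The events on the remaining indices [s'] belong to the statement because the
    step moves [X i] from [s'] into the fold. The operation stays abstract so as to serve both sums
    of spins and maxima of scores. *)
Lemma big_op_indep (d : measure_display) (T : measurableType d) (R : realType)
    (P : probability T R) (I : eqType) (X : I -> {RV P >-> R})
    (op : R -> R -> R) (x0 : R) (s : seq I) :
  mutually_independent X ->
  measurable_fun setT (fun p : R * R => op p.1 p.2) ->
  exists2 M : {RV P >-> R}, forall w, M w = \big[op/x0]_(i <- s) X i w &
    forall (s' : seq I) (A : set R) (B : I -> set R), uniq (s ++ s') ->
      measurable A -> (forall i, measurable (B i)) ->
      P (M @^-1` A `&` \bigcap_(i in [set` s']) (X i @^-1` B i)) =
      (P (M @^-1` A) * \prod_(i <- s') P (X i @^-1` B i))%E.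
Proof.
move=> indX mop; elim: s => [|i s [M ME indM]].
  exists (cst x0) => [w|s' A B us' mA mB]; first by rewrite big_nil.
  rewrite preimage_cst; case: ifPn => _.
    by rewrite setTI indX// probability_setT mul1e.
  by rewrite set0I measure0 mul0e.
have mM' : measurable_fun setT (fun w => op (X i w) (M w)).
  have mp : measurable_fun setT (fun w => (X i w, M w)).
    exact/measurable_fun_pair.
  exact: (measurableT_comp mop mp).
pose M' : {mfun T >-> R} := HB.pack (fun w => op (X i w) (M w))
  (isMeasurableFun.Build _ _ _ _ _ mM').
exists M' => [w|s' A B us' mA mB]; first by rewrite big_cons -ME.
(* In this order the induction hypothesis treats [i] as one of the remaining indices. *)
have us : uniq (s ++ i :: s') by rewrite -cat1s uniq_catCA.
pose E := \bigcap_(j in [set` s']) (X j @^-1` B j).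
have mE : measurable E.
  apply: fin_bigcap_measurable => [|j _]; first exact: finite_seq.
  exact: measurable_funPTI.
have PE : P E = (\prod_(j <- s') P (X j @^-1` B j))%E.
  by apply: indX => //; move: us; rewrite cat_uniq => /and3P[_ _ /andP[]].
pose D : set (R * R) := (fun p => op p.1 p.2) @^-1` A.
have mD : measurable D by rewrite -[D]setTI; exact: mop.
have isE (A1 : set R) (B1 : set R) : measurable A1 -> measurable B1 ->
    P (X i @^-1` A1 `&` (M @^-1` B1 `&` E)) =
    (P (X i @^-1` A1) * (P (M @^-1` B1) * P E))%E.
  move=> mA1 mB1.
  (* The condition on [X i] is merged into the family of events; since [i] is not in [s'], nothing
     changes on [s']. *)
  pose B' j := if j == i then A1 else B j.
  have B'i : B' i = A1 by rewrite /B' eqxx.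
  have s'B' j : j \in s' -> B' j = B j.
    rewrite /B'; case: eqP => // -> is'; move: us; rewrite cat_uniq /=.
    by rewrite is' /= !andbF.
  have := indM (i :: s') B1 B' us mB1.
  rewrite big_cons B'i muleCA PE.
  rewrite [in X in _ -> _ = X](eq_big_seq (fun j => P (X j @^-1` B' j)));
    last first.
    by move=> j js'; rewrite s'B'.
  move=> <-; last by move=> j; rewrite /B'; case: ifP.
  congr (P _); rewrite setICA; congr (_ `&` _).
  apply/seteqP; split => [w [XA Ew] j /=|w H].
    rewrite inE => /predU1P[->|js']; first by rewrite B'i.
    by rewrite s'B'//; exact: Ew.
  split; first by have := H i; rewrite /= inE eqxx B'i; exact.
  by move=> j /= js'; rewrite -s'B'//; apply: H; rewrite /= inE js' orbT.
have isT (A1 : set R) (B1 : set R) : measurable A1 -> measurable B1 ->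
    P (X i @^-1` A1 `&` (M @^-1` B1 `&` setT)) =
    (P (X i @^-1` A1) * (P (M @^-1` B1) * P setT))%E.
  move=> mA1 mB1; rewrite setIT probability_setT mule1.
  have := indM [:: i] B1 (fun=> A1).
  rewrite big_seq1 muleC setIC set_cons1 bigcap_set1; apply => //.
  rewrite -cat1s catA cat_uniq in us.
  by case/and3P : us.
rewrite -PE -/E.
have -> : M' @^-1` A = (fun w => (X i w, M w)) @^-1` D by [].
(* The joint law of [X i] and [M] is used twice: with [E] to factor the probability, then with the
   whole space to recognise the first factor as the law of [M']. *)
rewrite (joint_law_indep mE isE mD).
rewrite -[X in (_ = P X * _)%E]setIT (joint_law_indep measurableT isT mD).
by rewrite probability_setT mule1.
Qed.

Lemma big_op_joint_law (d : measure_display) (T : measurableType d)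
    (R : realType) (P : probability T R) (I : eqType) (X : I -> {RV P >-> R})
    (op : R -> R -> R) (x0 : R) (s : seq I) (j : I) :
  mutually_independent X ->
  measurable_fun setT (fun p : R * R => op p.1 p.2) ->
  uniq (j :: s) ->
  exists2 M : {RV P >-> R}, forall w, M w = \big[op/x0]_(i <- s) X i w &
    forall D : set (R * R), measurable D ->
      P ((fun w => (X j w, M w)) @^-1` D) =
      (distribution P (X j) \x distribution P M)%E D.
Proof.
move=> indX mop us; have [M ME indM] := big_op_indep x0 s indX mop.
exists M => // D mD.
rewrite -[X in P X = _]setIT (joint_law_indep measurableT _ mD).
  by rewrite probability_setT mule1.
move=> A B mA mB; rewrite setIT probability_setT mule1.
have := indM [:: j] B (fun=> A).
rewrite big_seq1 muleC setIC set_cons1 bigcap_set1; apply => //.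
by rewrite cats1 rcons_uniq.
Qed.

(** * Sums of uniform spins *)

(** The fundamental theorem of calculus. Since [f] has to be the derivative only on [[a, b]],
    integrands containing [Num.max] are covered where they are polynomial. *)
Lemma integral_deriv_poly (R : realType) (p : {poly R}) (f : R -> R) (a b : R) :
  a <= b -> (forall x, a <= x <= b -> f x = p^`().[x]) ->
  (\int[lebesgue_measure]_(x in `[a, b]) (f x)%:E = (p.[b] - p.[a])%:E)%E.
Proof.
move=> ab fE.
transitivity (\int[lebesgue_measure]_(x in `[a, b]) (p^`().[x])%:E)%E.
  by apply: eq_integral => x; rewrite inE /= in_itv /= => /fE ->.
have [<-|ab'] := eqVneq a b; first by rewrite set_itv1 integral_set1 subrr.
have ltab : a < b by rewrite lt_neqAle ab' ab.
have derp x : is_derive x (1 : R) (horner p) p^`().[x] by exact: is_derive_poly.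
rewrite (@continuous_FTC2 _ (horner p^`()) (horner p)) ?EFinB//.
- exact/continuous_subspaceT/continuous_horner.
- split=> [x _||]; first by have [] := derp x.
  + exact/cvg_at_right_filter/continuous_horner.
  + exact/cvg_at_left_filter/continuous_horner.
- by move=> x _; rewrite derive1E; have [_] := derp x.
Qed.

(** The image of Lebesgue measure under the translation gives half-open intervals their length,
    which characterises Lebesgue measure. *)
Lemma lebesgue_measure_shift (R : realType) (a : R) (B : set R) :
  measurable B ->
  lebesgue_measure ((fun x => a + x) @^-1` B) = lebesgue_measure B.
Proof.
move=> mB.
have mshift : measurable_fun setT ((fun x => a + x) : R -> measurableTypeR R).
  exact: measurable_funD.
pose mu_ : {measure set (measurableTypeR R) -> \bar R} :=
  pushforward lebesgue_measure ((fun x => a + x) : R -> measurableTypeR R).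
apply/esym/(lebesgue_measure_unique (mu := mu_ mshift)) => //.
move=> _ [[x y]] _ <-; rewrite /mu_ /= /pushforward.
rewrite (_ : _ @^-1` _ = `](x - a), (y - a)]%classic).
  rewrite !lebesgue_measure_itv /= !lte_fin ltrD2r -!EFinB.
  by rewrite (_ : y - a - (x - a) = y - x) //; ring.
apply/seteqP; split => z /=; rewrite !in_itv /=; lra.
Qed.

Lemma uniform01E (R : realType) (B : set R) : measurable B ->
  uniform_prob (@ltr01 R) B = lebesgue_measure (B `&` `[0, 1]).
Proof.
move=> mB; transitivity (\int[uniform_prob (@ltr01 R)]_x (\1_B x)%:E)%E.
  by rewrite integral_indic// setIT.
rewrite integral_uniform//; last exact/measurable_EFinP/measurable_indic.
by rewrite subr0 invr1 mul1e integral_indic.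
Qed.

Lemma spin_prob (d : measure_display) (T : measurableType d) (R : realType)
    (P : probability T R) (X : {RV P >-> R}) (B : set R) :
  uniform01 X -> measurable B ->
  P (X @^-1` B) = lebesgue_measure (B `&` `[0, 1]).
Proof. by move=> uniX mB; rewrite uniX// uniform01E. Qed.

(* [R] and [measurableTypeR R], which carries [lebesgue_measure], have the same
   measurable sets but different displays. *)
Lemma distribution_real (d : measure_display) (T : measurableType d)
    (R : realType) (P : probability T R) (X : {RV P >-> R}) :
  exists2 mu : {measure set (measurableTypeR R) -> \bar R},
    forall A, mu A = P (X @^-1` A) &
    forall f, measurable_fun setT f -> (forall x, (0 <= f x)%E) ->
      (\int[distribution P X]_x f x = \int[mu]_x f x)%E.
Proof.
have mX : measurable_fun setT (X : T -> measurableTypeR R).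
  exact: measurable_funPT X.
pose mu_ : {measure set (measurableTypeR R) -> \bar R} :=
  pushforward P (X : T -> measurableTypeR R).
exists (mu_ mX) => // f mf f0; rewrite ge0_integral_distribution//.
have := ge0_integral_pushforward mX P measurableT mf (fun y _ => f0 y).
by rewrite preimage_setT => <-.
Qed.

Lemma integral_spin (d : measure_display) (T : measurableType d) (R : realType)
    (P : probability T R) (X : {RV P >-> R}) (f : R -> \bar R) :
  uniform01 X -> measurable_fun setT f -> (forall x, (0 <= f x)%E) ->
  (\int[distribution P X]_x f x =
   \int[lebesgue_measure]_(x in `[0%R, 1%R]) f x)%E.
Proof.
move=> uniX mf f0; have := integral_uniform (@ltr01 R) mf f0.
rewrite subr0 invr1 mul1e => <-.
have [mu muE ->//] := distribution_real X.
by apply: eq_measure_integral => A mA _; rewrite muE; exact: uniX.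
Qed.

(** The first [m] spins have indices below [m], so [Z m] is the next spin and is independent of
    their sum. *)
Lemma partial_sum_joint_law (d : measure_display) (T : measurableType d)
    (R : realType) (P : probability T R) (Z : nat -> {RV P >-> R}) (m : nat) :
  mutually_independent Z ->
  exists2 M : {RV P >-> R}, forall w, M w = series (fun k => Z k w) m &
    forall D : set (R * R), measurable D ->
      P ((fun w => (Z m w, M w)) @^-1` D) =
      (distribution P (Z m) \x distribution P M)%E D.
Proof.
move=> indZ.
have madd : measurable_fun setT (fun p : R * R => p.1 + p.2).
  exact: measurable_funD.
apply: (big_op_joint_law (op := fun x y : R => x + y) 0
  (s := index_iota 0 m) indZ madd).
by rewrite /= mem_index_iota ltnn andbF iota_uniq.
Qed.

(** The volume of a simplex, which the bound 1 on the spins does not cut because [t <= 1]. The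
    [Num.max] covers negative arguments, which occur in the induction as [t - z]. The count starts
    at one spin: for the empty sum and [t <= 0] the formula would give 1 instead of 0. *)
Lemma partial_sum_cdf (d : measure_display) (T : measurableType d)
    (R : realType) (P : probability T R) (Z : nat -> {RV P >-> R}) (m : nat)
    (t : R) :
  mutually_independent Z -> (forall k, uniform01 (Z k)) -> t <= 1 ->
  P [set w | series (fun k => Z k w) m.+1 < t] =
  ((Num.max 0 t) ^+ m.+1 / m.+1`!%:R)%:E.
Proof.
move=> indZ uniZ; elim: m t => [|m IH] t t1.
  rewrite (_ : [set _ | _] = Z 0%N @^-1` `]-oo, t[); last first.
    by apply/seteqP; split => w /=; rewrite seriesEnat /= big_nat1 in_itv.
  rewrite (spin_prob (uniZ 0%N))// expr1 divr1.
  rewrite (_ : _ `&` _ = `[0, t[%classic); last first.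
    by apply/seteqP; split => x /=; rewrite !in_itv /=; lra.
  rewrite lebesgue_measure_itv /= lte_fin /Order.max.
  by case: ifPn => // _; rewrite -EFinB subr0.
have [M ME indM] := partial_sum_joint_law m.+1 indZ.
pose D : set (R * R) := [set p | p.1 + p.2 < t].
have mD : measurable D.
  rewrite -[D]setTI.
  apply: (measurable_fun_ltr (f := fun p : R * R => p.1 + p.2) (g := cst t)) => //.
  exact: measurable_funD.
rewrite (_ : [set _ | _] = (fun w => (Z m.+1 w, M w)) @^-1` D); last first.
  by apply/seteqP; split => w /=; rewrite /D /= ME (seriesS _ m.+1).
rewrite indM// /product_measure1 integral_spin//; last first.
  exact: measurable_fun_xsection.
(* Given the last spin [z], the earlier ones must sum to less than [t - z]. *)
transitivity (\int[lebesgue_measure]_(z in `[0%R, 1%R])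
    (Num.max 0 (t - z) ^+ m.+1 / m.+1`!%:R)%:E)%E.
  apply: eq_integral => z; rewrite inE /= in_itv /= => /andP[z0 z1].
  rewrite -IH; last lra.
  rewrite /distribution /pushforward; congr (P _).
  by apply/seteqP; split => w; rewrite /xsection /= inE /D /= ME; lra.
have [t0|t0] := leP t 0.
  rewrite expr0n /= mul0r; apply: integral0_eq => z /=.
  rewrite in_itv /= => /andP[z0 z1].
  by rewrite max_l ?expr0n /= ?mul0r//; lra.
(* The integrand vanishes beyond [t], and [t <= 1]; on [[0, t]] it is a polynomial. *)
transitivity (\int[lebesgue_measure]_(z in `[0%R, t])
    ((t - z) ^+ m.+1 / m.+1`!%:R)%:E)%E.
  rewrite integral_mkcond [RHS]integral_mkcond; apply: eq_integral => z _.
  rewrite !patchE !mem_setE !in_itv /=.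
  have [z0|z0] := leP 0 z => //=.
  have [zt|zt] := leP z t.
    by rewrite (le_trans zt t1) max_r// subr_ge0.
  by case: ifP => // _; rewrite max_l ?expr0n /= ?mul0r//; lra.
pose p : {poly R} := - (m.+2`!%:R^-1) *: (t%:P - 'X) ^+ m.+2.
rewrite (integral_deriv_poly (p := p))//; last 2 first.
- exact: ltW.
- move=> x _; rewrite /p derivZ deriv_exp derivB derivC derivX sub0r mulN1r succnK.
  rewrite hornerZ hornerMn hornerN horner_exp hornerD hornerC hornerN hornerX.
  have k0 : (m.+2%:R : R) != 0 by rewrite pnatr_eq0.
  have f0 : (m.+1`!%:R : R) != 0 by rewrite pnatr_eq0 -lt0n fact_gt0.
  rewrite [m.+2`!]factS natrM -[- _ *+ _]mulr_natr; move: k0 f0.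
  move: (m.+2%:R : R) (m.+1`!%:R : R) => k f k0 f0; field.
  by rewrite k0 f0.
rewrite /p !(hornerZ, horner_exp, hornerD, hornerN, hornerC, hornerX).
rewrite subrr subr0 expr0n /= mulr0 sub0r mulNr opprK.
by rewrite mulrC.
Qed.

Lemma expR_eseries (R : realType) (x : R) :
  (\sum_(0 <= m <oo) (exp_coeff x m)%:E = (expR x)%:E)%E.
Proof.
rewrite /expR -EFin_lim; last exact: is_cvg_series_exp_coeff.
by apply/congr_lim/funext => m /=; rewrite /series /= -sumEFin.
Qed.

Lemma measurable_partial_sum (d : measure_display) (T : measurableType d)
    (R : realType) (P : probability T R) (Z : nat -> {RV P >-> R}) (m : nat) :
  measurable_fun setT (fun w => series (fun k => Z k w) m).
Proof. by rewrite /series /=; apply: measurable_sum => k. Qed.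

(** Spins are in [[0, 1]] only almost surely; off this null set the partial sums are nonnegative and
    nondecreasing. *)
Lemma spin_lt0_negligible (d : measure_display) (T : measurableType d)
    (R : realType) (P : probability T R) (Z : nat -> {RV P >-> R}) :
  (forall k, uniform01 (Z k)) ->
  P.-negligible (\bigcup_k (Z k @^-1` `]-oo, 0[)).
Proof.
move=> uniZ; apply: negligible_bigcup => k.
apply/negligibleP; first exact: measurable_funPTI.
apply: etrans (spin_prob (uniZ k) _) _ => //.
rewrite (_ : _ `&` _ = set0) ?measure0//.
by apply/seteqP; split => x //=; rewrite !in_itv /=; lra.
Qed.

Lemma eq_measure_mod_negligible (d : measure_display) (T : measurableType d)
    (R : realType) (mu : {measure set T -> \bar R}) (A B N : set T) :
  measurable A -> measurable B -> mu.-negligible N ->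
  A `<=` B `|` N -> B `<=` A `|` N -> mu A = mu B.
Proof.
move=> mA mB [N' [mN' muN' NN']].
suff le C D : measurable C -> measurable D -> C `<=` D `|` N ->
    (mu C <= mu D)%E.
  by move=> AB BA; apply/le_anti/andP; split; exact: le.
move=> mC mD CD; rewrite -[leRHS]adde0 -muN'.
apply: le_trans (measureU2 mu mD mN').
apply: le_measure; rewrite ?inE//; first exact: measurableU.
by apply: (subset_trans CD); exact: setUS.
Qed.

(** Given a sum [u] in [[0, tau[], the next spin must fall in the translate of [B] by [- u]. As [B]
    lies in [[tau, 1]], this translate stays in [[0, 1]], so its probability is the measure of [B]
    whatever [u] is. *)
Lemma partial_sum_step_prob (d : measure_display) (T : measurableType d)
    (R : realType) (P : probability T R) (Z : nat -> {RV P >-> R}) (m : nat)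
    (tau : R) (B : set R) :
  mutually_independent Z -> (forall k, uniform01 (Z k)) ->
  0 <= tau <= 1 -> measurable B -> B `<=` `[tau, 1]%classic ->
  P [set w | 0 <= series (fun k => Z k w) m.+1 < tau /\
             B (series (fun k => Z k w) m.+2)] =
  ((exp_coeff tau m.+1)%:E * lebesgue_measure B)%E.
Proof.
move=> indZ uniZ /andP[tau0 tau1] mB Btau.
have [M ME indM] := partial_sum_joint_law m.+1 indZ.
pose J : set R := `[0, tau[%classic.
have mJ : measurable J by exact: measurable_itv.
pose D : set (R * R) := (setT `*` J) `&` (fun p => p.2 + p.1) @^-1` B.
have mD : measurable D.
  apply: measurableI; first exact: measurableX.
  have madd : measurable_fun setT (fun p : R * R => p.2 + p.1).
    exact: measurable_funD.
  by rewrite -[X in measurable X]setTI; exact: madd.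
rewrite (_ : [set _ | _] = (fun w => (Z m.+1 w, M w)) @^-1` D); last first.
  apply/seteqP; split => w; rewrite /D /J /= in_itv /= ME (seriesSr _ m.+1).
    by move=> [? ?].
  by move=> [[_ ?] ?].
rewrite indM//.
(* The order of integration is exchanged: the sum is now the outer variable and the next spin the
   inner one. *)
transitivity ((distribution P (Z m.+1) \x^ distribution P M)%E D).
  apply: product_measure_unique => // A1 A2 mA1 mA2.
  exact: product_measure2E.
rewrite /product_measure2.
transitivity (\int[distribution P M]_u ((\1_J u)%:E * lebesgue_measure B))%E.
  apply: eq_integral => u _ /=; rewrite indicE.
  have [uJ|uJ] := boolP (u \in J); last first.
    rewrite mul0e (_ : ysection D u = set0) ?measure0//.
    apply/seteqP; split => z //=; rewrite /ysection /= inE => -[[_ /=]].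
    by move: uJ; rewrite notin_setE.
  rewrite mul1e -(lebesgue_measure_shift u mB).
  have mBu : measurable ((fun x => u + x) @^-1` B).
    have mshift : measurable_fun setT (fun x : R => u + x).
      exact: measurable_funD.
    by rewrite -[X in measurable X]setTI; exact: mshift.
  rewrite (_ : ysection D u = (fun x => u + x) @^-1` B); last first.
    apply/seteqP; split => z /=; rewrite /ysection /= inE; first by case.
    by move=> Bz; split => //; split => //; rewrite inE in uJ.
  rewrite /distribution /pushforward spin_prob//; congr (lebesgue_measure _).
  apply: setIidl => z /= /Btau /=; move: uJ; rewrite inE /J /= !in_itv /=.
  by move=> /andP[u0 utau] /andP[tauuz uz1]; apply/andP; split; lra.
rewrite ge0_integralZr//; last first.
  exact/measurable_EFinP/measurable_indic.
rewrite integral_indic// setIT; congr (_ * _)%E.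
(* The remaining factor is the probability that [M] is in [[0, tau[]; negative values have
   probability 0, so the distribution function at [tau] gives it. *)
have cdf t : t <= 1 -> P (M @^-1` `]-oo, t[) =
    ((Num.max 0 t) ^+ m.+1 / m.+1`!%:R)%:E.
  move=> t1; rewrite -(partial_sum_cdf m indZ uniZ t1); congr (P _).
  by apply/seteqP; split => w /=; rewrite in_itv /= ME.
have -> : exp_coeff tau m.+1 = (Num.max 0 tau) ^+ m.+1 / m.+1`!%:R.
  by rewrite /exp_coeff max_r.
rewrite -(cdf tau tau1) /distribution /pushforward.
have P0 : P (M @^-1` `]-oo, 0[) = 0%E.
  by rewrite cdf// maxxx expr0n /= mul0r.
apply: (@eq_measure_mod_negligible _ _ _ _ _ _ (M @^-1` `]-oo, 0[)).
- exact: measurable_funPTI.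
- exact: measurable_funPTI.
- by exists (M @^-1` `]-oo, 0[); split => //; exact: measurable_funPTI.
- by move=> w /=; rewrite /J /= !in_itv /= => /andP[_ ->]; left.
- by move=> w /=; rewrite /J /= !in_itv /= => ->; case: leP => _; [left|right].
Qed.

Lemma expR_eseriesZl (R : realType) (c x : R) : 0 <= x ->
  (\sum_(0 <= m <oo) (c%:E * (exp_coeff x m)%:E) = c%:E * (expR x)%:E)%E.
Proof.
move=> x0; rewrite nneseriesZl; first by rewrite expR_eseries.
by move=> m _; rewrite lee_fin; exact: exp_coeff_ge0.
Qed.

(** * Law of the score *)

(** The index counts the spins before the stopping one, so that it matches the index of the
    exponential series. *)
Definition stops_after (R : realType) (tau : R) (z : nat -> R) (m : nat) : Prop :=
  (forall j, (j <= m)%N -> ~~ reached tau z j) /\ tau <= series z m.+1.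

Lemma scoreE (R : realType) (tau : R) (z : nat -> R) (m : nat) :
  stops_after tau z m ->
  score tau z = if series z m.+1 <= 1 then series z m.+1 else 0.
Proof.
move=> [before at_m]; rewrite /score; case: pselect => [h|[]]; last first.
  by exists m.+1; rewrite /reached /= at_m.
have reached_m : reached tau z m.+1 by rewrite /reached /= at_m.
case: ex_minnP => k reached_k min_k.
suff -> : k = m.+1 by [].
apply/eqP; rewrite eqn_leq min_k //= ltnNge.
by apply/negP => /before; rewrite reached_k.
Qed.

(** Overshooting 1 and never stopping both give the default score 0, so a nonzero score is a genuine
    stopped sum. *)
Lemma score_neq0_stops (R : realType) (tau : R) (z : nat -> R) :
  score tau z != 0 ->
  exists2 m, stops_after tau z m &
    score tau z = series z m.+1 /\ series z m.+1 <= 1.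
Proof.
move=> s0.
suff [m hm] : exists m, stops_after tau z m.
  exists m => //; move: s0; rewrite (scoreE hm).
  by case: ifP => // _; rewrite eqxx.
move: s0; rewrite /score; case: pselect => [h _|]; last by rewrite eqxx.
case: (ex_minnP h) => -[|m]; first by rewrite /reached.
move=> /andP[_ at_m] min_m; exists m; split => // j jm.
by apply/negP => /min_m; rewrite ltnNge jm.
Qed.

(** The event is split according to the number [m] of spins before the stopping one. The part for
    [m] has probability [exp_coeff tau m] times the measure of [C], and these coefficients sum to
    [expR tau]. *)
Lemma score_prob (d : measure_display) (T : measurableType d) (R : realType)
    (P : probability T R) (Z : nat -> {RV P >-> R}) (tau : R) (B : set R) :
  mutually_independent Z -> (forall k, uniform01 (Z k)) ->
  0 <= tau <= 1 -> measurable B -> ~ B 0 ->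
  P [set w | B (score tau (fun k => Z k w))] =
  ((expR tau)%:E * lebesgue_measure (B `&` `[tau, 1%R]))%E.
Proof.
move=> indZ uniZ tau01 mB B0.
pose C := B `&` `[tau, 1]%classic.
have mC : measurable C by apply: measurableI => //; exact: measurable_itv.
pose z w : nat -> R := fun k => Z k w.
pose A m := [set w | (forall j, (j <= m)%N -> ~~ reached tau (z w) j)] `&`
  [set w | C (series (z w) m.+1)].
have mseries (m : nat) (D : set R) : measurable D ->
    measurable [set w | D (series (z w) m)].
  move=> mD; rewrite -[X in measurable X]setTI.
  exact: (measurable_partial_sum Z m).
have mA m : measurable (A m).
  apply: measurableI; last exact: mseries.
  rewrite (_ : [set _ | _] =
    \bigcap_(j in [set j | (0 < j <= m)%N]) [set w | series (z w) j < tau]).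
    apply: bigcap_measurableType => j _.
    rewrite (_ : [set w | _] = [set w | `]-oo, tau[%classic (series (z w) j)]).
      by apply: mseries; exact: measurable_itv.
    by apply/seteqP; split => w /=; rewrite in_itv.
  apply/seteqP; split => w H j.
    move=> /= /andP[j0 jm].
    by have := H j jm; rewrite /reached j0 /= -ltNge.
  move=> jm; have := H j; rewrite /reached /= jm andbT ltNge.
  by case: (0 < j)%N => //=; exact.
rewrite (_ : [set w | _] = \bigcup_m A m); last first.
  apply/seteqP; split => w /=.
    move=> Bs; have /score_neq0_stops[m [before at_m] [sE le1]] :
      score tau (z w) != 0 by apply: contra_notN B0 => /eqP <-.
    exists m => //; split => //=; split; first by rewrite -sE.
    by rewrite /= in_itv /= at_m.
  move=> [m _ [before [Bs]]]; rewrite /= in_itv /= => /andP[at_m le1].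
  by rewrite (@scoreE _ _ _ m) ?le1.
rewrite measure_semi_bigcup//; last 2 first.
- have disj m k w : (m < k)%N -> A m w -> A k w -> False.
    move=> mk [_ [_]]; rewrite /= in_itv /= => /andP[at_m _] [/(_ m.+1 mk)].
    by rewrite /reached /= at_m.
  move=> m k _ _ [w [Am Ak]].
  by case: (ltngtP m k) => // [/disj/(_ Am Ak)|/disj/(_ Ak Am)].
- exact: bigcupT_measurable.
have C_fin : lebesgue_measure C \is a fin_num.
  rewrite ge0_fin_numE//.
  apply: (@le_lt_trans _ _ (lebesgue_measure (`[0, 1]%classic : set R))).
    apply: le_measure; rewrite ?inE//.
    by move=> x [_] /=; rewrite !in_itv /=; lra.
  by rewrite lebesgue_measure_itv /= lte_fin ltr01 -EFinB ltry.
rewrite -(fineK C_fin) muleC -(expR_eseriesZl _ (proj1 (andP tau01))).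
apply: eq_eseriesr => m _; rewrite fineK// muleC.
(* A stop at the first spin has no preceding sum to condition on and is computed directly, with
   coefficient 1. *)
case: m => [|m].
  have -> : exp_coeff tau 0 = 1 by rewrite /exp_coeff /= expr0 divr1.
  rewrite mul1e.
  rewrite (_ : A 0%N = Z 0%N @^-1` C).
    apply: etrans (spin_prob (uniZ 0%N) mC) _.
    congr (lebesgue_measure _); apply: setIidl => x [_].
    by rewrite /= !in_itv /=; lra.
  apply/seteqP; split => w; rewrite /A /= seriesSr /series /= big_geq// add0r.
    by case.
  by move=> Cw; split => // j; rewrite leqn0 => /eqP ->.
rewrite -(partial_sum_step_prob m indZ uniZ tau01 mC (@subIsetr _ _ _)).
have [tau0 tau1] := andP tau01.
(* [A m.+1] asks all earlier sums to be below [tau], the step formula only the last one; for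
   nonnegative spins the sums increase and the two conditions agree. *)
apply: (@eq_measure_mod_negligible _ _ _ _ _ _
  (\bigcup_k (Z k @^-1` `]-oo, 0[))) => //.
- rewrite (_ : [set w | _] =
    [set w | `[0, tau[%classic (series (z w) m.+1)] `&`
    [set w | C (series (z w) m.+2)]).
    by apply: measurableI; apply: mseries => //; exact: measurable_itv.
  by apply/seteqP; split => w /=; rewrite in_itv.
- exact: spin_lt0_negligible.
- move=> w [before Cw].
  have [neg|nonneg] := pselect (exists k, Z k w < 0).
    by right; case: neg => k Zk; exists k => //=; rewrite in_itv.
  left; split => //.
  have := before m.+1 (leqnn _); rewrite /reached /= -ltNge => ->.
  rewrite andbT; apply: sumr_ge0 => k _; rewrite leNgt.
  by apply/negP => Zk; apply: nonneg; exists k.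
- move=> w [/andP[_ lt_tau] Cw].
  have [neg|nonneg] := pselect (exists k, Z k w < 0).
    by right; case: neg => k Zk; exists k => //=; rewrite in_itv.
  left; split => //= j jm; rewrite /reached negb_and -leqNgt -ltNge.
  apply/orP; right; apply: le_lt_trans lt_tau.
  have : {homo series (z w) : x y / (x <= y)%N >-> x <= y}.
    apply/nondecreasing_seqP => k; rewrite seriesSr lerDl leNgt.
    by apply/negP => Zk; apply: nonneg; exists k.
  by apply.
Qed.

(** Sets avoiding 0 suffice: the total mass being 1, the atom at 0 is obtained by complement. *)
Definition score_law (d : measure_display) (T : measurableType d) (R : realType)
    (P : probability T R) (X : {RV P >-> R}) (tau : R) : Prop :=
  forall B : set R, measurable B -> ~ B 0 ->
    P (X @^-1` B) = ((expR tau)%:E * lebesgue_measure (B `&` `[tau, 1%R]))%E.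

(* [score_cdf tau x] is the probability that the score is less than [x], for
   [0 < x <= 1]; on the diagonal it is the probability of a zero score. *)
Definition score_cdf (R : realType) (tau x : R) : R :=
  1 - expR tau * (1 - Num.max tau x).

Lemma score_law_ge (d : measure_display) (T : measurableType d) (R : realType)
    (P : probability T R) (X : {RV P >-> R}) (tau x : R) :
  score_law X tau -> tau <= 1 -> 0 < x <= 1 ->
  P (X @^-1` `[x, +oo[) = (expR tau * (1 - Num.max tau x))%:E.
Proof.
move=> lawX tau1 /andP[x0 x1].
rewrite lawX; [|exact: measurable_itv|by rewrite /= in_itv /= andbT leNgt x0].
rewrite (_ : _ `&` _ = `[Num.max tau x, 1]%classic); last first.
  apply/seteqP; split => y /=; rewrite !in_itv /= ge_max andbT.
    by move=> [-> /andP[-> ->]].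
  by move=> /andP[/andP[-> ->] ->].
rewrite lebesgue_measure_itv /= lte_fin EFinM; congr (_ * _)%E.
have : Num.max tau x <= 1 by rewrite ge_max tau1.
by rewrite le_eqVlt => /predU1P[->|->]; rewrite ?ltxx ?subrr.
Qed.

Lemma score_law_lt (d : measure_display) (T : measurableType d) (R : realType)
    (P : probability T R) (X : {RV P >-> R}) (tau x : R) :
  score_law X tau -> tau <= 1 -> 0 < x <= 1 ->
  P (X @^-1` `]-oo, x[) = (score_cdf tau x)%:E.
Proof.
move=> lawX tau1 x01.
rewrite (_ : X @^-1` _ = ~` (X @^-1` `[x, +oo[)); last first.
  by apply/seteqP; split => w /=; rewrite !in_itv /= andbT ltNge => /negP.
rewrite probability_setC; last exact: measurable_funPTI.
by rewrite (score_law_ge lawX tau1 x01).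
Qed.

Lemma score_law_le0 (d : measure_display) (T : measurableType d) (R : realType)
    (P : probability T R) (X : {RV P >-> R}) (tau x : R) :
  score_law X tau -> 0 <= tau -> x <= 0 ->
  P (X @^-1` `]-oo, x[) = 0%E.
Proof.
move=> lawX tau0 x0.
rewrite lawX; [|exact: measurable_itv|by rewrite /= in_itv /= ltNge x0].
rewrite (_ : _ `&` _ = set0) ?measure0 ?mule0//.
by apply/seteqP; split => y //=; rewrite !in_itv /=; lra.
Qed.

Lemma score_law_eq0 (d : measure_display) (T : measurableType d) (R : realType)
    (P : probability T R) (X : {RV P >-> R}) (tau : R) :
  score_law X tau -> 0 <= tau <= 1 ->
  P (X @^-1` [set 0]) = (score_cdf tau tau)%:E.
Proof.
move=> lawX /andP[tau0 tau1].
rewrite -[X @^-1` _]setCK preimage_setC.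
rewrite probability_setC; last by apply: measurable_funPTI; exact: measurableC.
rewrite lawX; [|exact: measurableC|by apply].
(* For [tau = 0] the removed point belongs to the interval, hence the squeeze between []tau, 1]] and
   [[tau, 1]]. *)
have -> : lebesgue_measure (~` [set 0] `&` `[tau, 1]%classic) = (1 - tau)%:E.
  transitivity (lebesgue_measure (`]tau, 1]%classic : set R)).
    apply/eqP; rewrite eq_le; apply/andP; split.
      apply: (@le_trans _ _ (lebesgue_measure (`[tau, 1]%classic : set R))).
        apply: le_measure; rewrite ?inE//.
        by apply: measurableI => //; exact: measurableC.
      by rewrite !lebesgue_measure_itv.
    apply: le_measure; rewrite ?inE//.
      by apply: measurableI => //; exact: measurableC.
    move=> y /=; rewrite !in_itv /= => /andP[tauy ->].
    rewrite (ltW tauy); split => // y0; move: tauy; rewrite y0.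
    by rewrite ltNge tau0.
  rewrite lebesgue_measure_itv /= lte_fin.
  by move: tau1; rewrite le_eqVlt => /predU1P[->|->]; rewrite ?ltxx ?subrr.
by rewrite /score_cdf maxxx.
Qed.

(** As [f] vanishes on nonpositive arguments, the atom at 0 contributes nothing. The interval is
    open at [tau] so that it avoids 0 even when [tau = 0]. *)
Lemma integral_score_law (d : measure_display) (T : measurableType d)
    (R : realType) (P : probability T R) (X : {RV P >-> R}) (tau : R)
    (f : R -> \bar R) :
  score_law X tau -> 0 <= tau ->
  measurable_fun setT f -> (forall x, (0 <= f x)%E) ->
  (forall x, x <= 0 -> f x = 0%E) ->
  (\int[distribution P X]_x f x =
   (expR tau)%:E * \int[lebesgue_measure]_(x in `]tau, 1%R]) f x)%E.
Proof.
move=> lawX tau0 mf f0 f_le0.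
have [mu muE ->//] := distribution_real X.
pose D : set (measurableTypeR R) := `]tau, 1]%classic.
have mD : measurable D by exact: measurable_itv.
have D_pos x : D x -> 0 < x.
  by rewrite /D /= in_itv /= => /andP[+ _]; exact: le_lt_trans.
(* The positive values outside [D] form a null set: they meet [[tau, 1]] at most in [tau]. *)
pose E : set (measurableTypeR R) := `]0, +oo[%classic `\` D.
have mE : measurable E by apply: measurableD => //; exact: measurable_itv.
have muC (A : set R) : measurable A -> (forall x, A x -> 0 < x) ->
    mu A = ((expR tau)%:E * lebesgue_measure (A `&` `[tau, 1%R]%classic))%E.
  by move=> mA A_pos; rewrite muE lawX// => /A_pos; rewrite ltxx.
have muE0 : mu E = 0%E.
  rewrite muC//; last first.
    by move=> x [] /=; rewrite in_itv /= andbT.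
  rewrite (_ : lebesgue_measure _ = 0%E) ?mule0//.
  apply/eqP; rewrite -measure_le0.
  apply: (@le_trans _ _ (lebesgue_measure ([set tau] : set R))).
    apply: le_measure; rewrite ?inE//.
      by apply: measurableI => //; exact: measurable_itv.
    move=> x [[_]]; rewrite /D /= !in_itv /= => /negP.
    by rewrite negb_and -leNgt -ltNge; lra.
  by rewrite lebesgue_measure_set1.
transitivity (\int[mu]_(x in D `|` E) f x)%E.
  rewrite [RHS]integral_mkcond; apply: eq_integral => x _.
  rewrite patchE; case: ifPn => //.
  rewrite notin_setE => DE; apply: f_le0; rewrite leNgt; apply/negP => x0.
  apply: DE; have [|nD] := pselect (D x); first by left.
  by right; split => //=; rewrite in_itv /= x0.
have DE0 : [disjoint D & E].
  by apply/disj_setPS => x [Dx []].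
rewrite ge0_integral_setU//; last exact: measurable_funTS.
rewrite (null_set_integral _ _ muE0)// ?adde0; last exact: measurable_funTS.
pose k : {nonneg R} := NngNum (expR_ge0 tau).
transitivity (\int[mscale k lebesgue_measure]_(x in D) f x)%E.
  apply: eq_measure_integral => A mA AD; rewrite /mscale /=.
  rewrite muC//; last by move=> x /AD /D_pos.
  congr (_ * lebesgue_measure _)%E; apply: setIidl => x /AD.
  by rewrite /D /= !in_itv /= => /andP[/ltW -> ->].
by rewrite ge0_integral_mscale//; exact: measurable_funTS.
Qed.

Lemma continuous_score_cdf (R : realType) (tau : R) : continuous (score_cdf tau).
Proof.
move=> x; rewrite /score_cdf; apply: cvgB; first exact: cvg_cst.
apply: cvgMr; apply: cvgB; first exact: cvg_cst.
by apply: continuous_max; [exact: cvg_cst|exact: cvg_id].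
Qed.

(** * Winning probabilities *)

(** Conditioning on the score [x] of player [i], which has density [expR (kappa i)], leaves the
    probability that the maximum [M] of the other scores is below [x]; by independence this is the
    product. *)
Lemma prob_beats_all (d : measure_display) (T : measurableType d)
    (R : realType) (P : probability T R) (n : nat)
    (X : 'I_n -> {RV P >-> R}) (kappa : 'I_n -> R) (i : 'I_n) :
  (1 < n)%N -> mutually_independent X ->
  (forall j, score_law (X j) (kappa j)) ->
  (forall j, 0 <= kappa j <= 1) ->
  P [set w | forall j, j != i -> X j w < X i w] =
  ((expR (kappa i))%:E * \int[lebesgue_measure]_(x in `[kappa i, 1%R])
     (\prod_(j | j != i) score_cdf (kappa j) x)%:E)%E.
Proof.
move=> n1 indX lawX kappa01.
have kappa0 j : 0 <= kappa j by case/andP: (kappa01 j).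
have kappa1 j : kappa j <= 1 by case/andP: (kappa01 j).
pose s := [seq j <- enum 'I_n | j != i].
have us : uniq (i :: s).
  by rewrite /= mem_filter eqxx /= filter_uniq// enum_uniq.
have mem_s j : (j \in s) = (j != i) by rewrite mem_filter mem_enum andbT.
(* An opponent bounds [M] from below by a score, so [M] is almost surely not negative. *)
have [j0 j0i] : exists j0 : 'I_n, j0 != i.
  have n0 : (0 < n)%N by exact: ltn_trans n1.
  have [->|i0] := eqVneq i (Ordinal n0); first by exists (Ordinal n1).
  by exists (Ordinal n0); rewrite eq_sym.
have mmax : measurable_fun setT (fun p : R * R => Num.max p.1 p.2).
  exact: measurable_maxr.
have [M ME indM] := big_op_joint_law (-1) indX mmax us.
have M_lt w x : (M w < x) = (-1 < x) && [forall j, (j != i) ==> (X j w < x)].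
  rewrite ME big_filter big_enum_cond /=; apply/bigmax_ltP/andP => -[x1 lt_x].
    by split => //; apply/forallP => j; apply/implyP; exact: lt_x.
  by split => // j ji; have /implyP := forallP lt_x j; exact.
pose D : set (R * R) := [set p | p.2 < p.1].
have mD : measurable D.
  by rewrite -[D]setTI; exact: (measurable_fun_ltr (f := snd) (g := fst)).
have X_ge0 j : P (X j @^-1` `]-oo, 0[) = 0%E.
  exact: (score_law_le0 (lawX j)).
(* The events differ only where [X i < 0], as [M] is a maximum seeded by -1. *)
transitivity (P ((fun w => (X i w, M w)) @^-1` D)).
  apply: (@eq_measure_mod_negligible _ _ _ _ _ _ (X i @^-1` `]-oo, 0[)).
  - rewrite (_ : [set w | _] =
        \bigcap_(j in [set j | j != i]) [set w | X j w < X i w]).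
      apply: fin_bigcap_measurable => [|j _]; first exact: finite_finset.
      rewrite -[X in measurable X]setTI.
      exact: measurable_fun_ltr.
    by [].
  - rewrite -[X in measurable X]setTI.
    have mXM : measurable_fun setT (fun w => (X i w, M w)).
      exact/measurable_fun_pair.
    exact: mXM.
  - exists (X i @^-1` `]-oo, 0[); split => //; first exact: measurable_funPTI.
    exact: X_ge0.
  - move=> w lt_i; have [Xi0|Xi0] := ltP (X i w) 0.
      by right; rewrite /= in_itv.
    left; rewrite /D /= M_lt; apply/andP; split.
      by apply: lt_le_trans Xi0; rewrite ltrN10.
    by apply/forallP => j; apply/implyP; exact: lt_i.
  - move=> w; rewrite /D /= M_lt => /andP[_ /forallP lt_i]; left => j ji.
    by have /implyP := lt_i j; exact.
rewrite indM// /product_measure1.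
have M_lt_le0 x : x <= 0 -> P (M @^-1` `]-oo, x[) = 0%E.
  move=> x0; apply/eqP; rewrite -measure_le0.
  rewrite -(score_law_le0 (lawX j0) (kappa0 j0) x0).
  apply: le_measure; rewrite ?inE; try exact: measurable_funPTI.
  move=> w /=; rewrite !in_itv /= M_lt => /andP[_ /forallP/(_ j0)].
  by rewrite j0i.
have sectionE x : (distribution P M \o xsection D) x = P (M @^-1` `]-oo, x[).
  rewrite /= /distribution /pushforward; congr (P _); apply/seteqP.
  by split => w; rewrite /xsection /= inE /D /= in_itv.
rewrite (integral_score_law (lawX i))//; first last.
- by move=> x x0; rewrite sectionE M_lt_le0.
- exact: measurable_fun_xsection.
have prodE x : \prod_(j | j != i) score_cdf (kappa j) x =
    \prod_(j <- s) score_cdf (kappa j) x.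
  by rewrite big_filter big_enum_cond.
under [X in _ = (_ * X)%E]eq_integral => x _ do rewrite prodE.
(* Dropping the endpoint [kappa i] makes [x] positive, where [score_cdf] is the distribution
   function. *)
congr (_ * _)%E; rewrite -[RHS]integral_itv_obnd_cbnd; last first.
  apply/measurable_EFinP/measurable_funTS/measurable_prod => j js.
  by apply: continuous_measurable_fun; exact: continuous_score_cdf.
apply: eq_integral => x; rewrite inE /= in_itv /= => /andP[kx x1].
have x0 : 0 < x by apply: le_lt_trans kx.
have x01 : 0 < x <= 1 by rewrite x0 x1.
apply: etrans (sectionE x) _.
rewrite (_ : M @^-1` _ = \bigcap_(j in [set` s]) (X j @^-1` `]-oo, x[)); last first.
  apply/seteqP; split => w /=; rewrite in_itv /= M_lt.
    move=> /andP[_ /forallP lt_x] j /=; rewrite mem_s in_itv /= => ji.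
    by have /implyP := lt_x j; exact.
  move=> lt_x; rewrite (lt_trans _ x0) ?ltrN10//=.
  apply/forallP => j; apply/implyP => ji.
  by have := lt_x j; rewrite /= mem_s in_itv /=; exact.
rewrite indX//; last by case/andP: us.
rewrite (eq_bigr (fun j => (score_cdf (kappa j) x)%:E)); last first.
  by move=> j _; exact: score_law_lt.
by rewrite prodEFin.
Qed.

(** The first summand is the probability that all scores are 0, the second that player [i] beats
    everybody else. *)
Definition win_chance (R : realType) (n : nat) (adv : 'I_n)
    (kappa : 'I_n -> R) (i : 'I_n) : R :=
  (if i == adv then \prod_j score_cdf (kappa j) (kappa j) else 0) +
  expR (kappa i) * \int[lebesgue_measure]_(x in `[kappa i, 1])
    (\prod_(j | j != i) score_cdf (kappa j) x).

Lemma continuous_prod_score_cdf (R : realType) (I : finType) (A : pred I)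
    (kappa : I -> R) :
  continuous (fun x => \prod_(j | A j) score_cdf (kappa j) x).
Proof.
apply: continuous_big => [|j _]; first exact: mul_continuous.
exact: continuous_score_cdf.
Qed.

Lemma integrable_continuous_itv (R : realType) (f : R -> R) (a b : R) :
  continuous f -> lebesgue_measure.-integrable `[a, b] (EFin \o f).
Proof.
move=> cf; apply: continuous_compact_integrable; first exact: segment_compact.
exact: continuous_subspaceT.
Qed.

Lemma integral_continuous_EFin (R : realType) (f : R -> R) (a b : R) :
  continuous f ->
  (\int[lebesgue_measure]_(x in `[a, b]) (f x)%:E)%E =
  (\int[lebesgue_measure]_(x in `[a, b]) f x)%:E.
Proof.
move=> cf; rewrite /Rintegral fineK//; apply: integrable_fin_num => //.
exact: integrable_continuous_itv.
Qed.

Lemma measurable_forall_ord (d : measure_display) (T : measurableType d)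
    (n : nat) (A : pred 'I_n) (F : 'I_n -> set T) :
  (forall j, measurable (F j)) -> measurable [set w | forall j, A j -> F j w].
Proof.
move=> mF; rewrite (_ : [set w | _] = \bigcap_(j in [set j | A j]) F j).
  by apply: fin_bigcap_measurable => //; exact: finite_finset.
by [].
Qed.

Lemma measurable_wins (d : measure_display) (T : measurableType d)
    (R : realType) (P : probability T R) (n : nat) (adv : 'I_n)
    (X : 'I_n -> {RV P >-> R}) (i : 'I_n) :
  measurable [set w | wins adv (fun j => X j w) i].
Proof.
rewrite (_ : [set w | _] = [set w | forall j, j != i -> X j w < X i w] `|`
    [set w | i = adv /\ forall j : 'I_n, true -> X j w = 0]).
  apply: measurableU.
    apply: measurable_forall_ord => j; rewrite -[X in measurable X]setTI.
    exact: measurable_fun_ltr.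
  have [ia|ia] := eqVneq i adv.
    rewrite (_ : [set w | _] = [set w | forall j : 'I_n, true -> X j w = 0]).
      apply: measurable_forall_ord => j.
      exact: (measurable_funPTI (X j) (measurable_set1 0)).
    by apply/seteqP; split => w //= -[].
  rewrite (_ : [set w | _] = set0) //; apply/seteqP; split => w //= -[iadv].
  by rewrite iadv eqxx in ia.
apply/seteqP; split => w; rewrite /wins /=.
  move=> /orP[/forallP lt_i|/andP[/eqP -> /forallP X0]].
    by left => j; apply/implyP; exact: lt_i.
  by right; split => // j _; apply/eqP; exact: X0.
move=> [lt_i|[-> X0]]; apply/orP.
  by left; apply/forallP => j; apply/implyP; exact: lt_i.
by right; rewrite eqxx; apply/forallP => j; apply/eqP; exact: X0.
Qed.

Lemma prob_wins (d : measure_display) (T : measurableType d)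
    (R : realType) (P : probability T R) (n : nat) (adv : 'I_n)
    (X : 'I_n -> {RV P >-> R}) (kappa : 'I_n -> R) (i : 'I_n) :
  (1 < n)%N -> mutually_independent X ->
  (forall j, score_law (X j) (kappa j)) ->
  (forall j, 0 <= kappa j <= 1) ->
  P [set w | wins adv (fun j => X j w) i] = (win_chance adv kappa i)%:E.
Proof.
move=> n1 indX lawX kappa01.
have beatsE := prob_beats_all i n1 indX lawX kappa01.
rewrite integral_continuous_EFin in beatsE; last exact: continuous_prod_score_cdf.
rewrite /win_chance; have [ia|ia] := eqVneq i adv; last first.
  rewrite add0r EFinM -beatsE; congr (P _).
  apply/seteqP; split => w; rewrite /wins /= (negbTE ia) orbF.
    by move=> /forallP lt_i j; apply/implyP; exact: lt_i.
  by move=> lt_i; apply/forallP => j; apply/implyP; exact: lt_i.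
pose Z0 := \bigcap_(j in [set` enum 'I_n]) (X j @^-1` [set 0]).
have mZ0 : measurable Z0.
  apply: fin_bigcap_measurable; first exact: finite_seq.
  by move=> j _; exact: measurable_funPTI.
pose L := [set w | forall j, j != i -> X j w < X i w].
have mL : measurable L.
  apply: measurable_forall_ord => j; rewrite -[X in measurable X]setTI.
  exact: measurable_fun_ltr.
rewrite (_ : [set w | _] = Z0 `|` L); last first.
  apply/seteqP; split => w; rewrite /wins /= ia eqxx.
    move=> /orP[/forallP lt_i|/forallP X0].
      by right => j; rewrite ia; apply/implyP; exact: lt_i.
    by left => j _; apply/eqP; exact: X0.
  move=> [X0|lt_i]; apply/orP.
    by right; apply/forallP => j; apply/eqP/X0; rewrite /= mem_enum.
  by left; apply/forallP => j; apply/implyP; rewrite -ia; exact: lt_i.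
(* With an opponent present, beating everybody and all scores being 0 are disjoint events. *)
have [j0 j0i] : exists j0 : 'I_n, j0 != i.
  have n0 : (0 < n)%N by exact: ltn_trans n1.
  have [->|i0] := eqVneq i (Ordinal n0); first by exists (Ordinal n1).
  by exists (Ordinal n0); rewrite eq_sym.
rewrite measureU//; last first.
  apply/seteqP; split => w //= -[X0 /(_ j0 j0i)].
  have XE j : X j w = 0 by apply: X0; rewrite /= mem_enum.
  by rewrite !XE ltxx.
rewrite EFinD EFinM -beatsE; congr (_ + _)%E.
apply: etrans (indX (enum 'I_n) (fun=> [set 0]) (enum_uniq _) _) _ => //.
rewrite (eq_bigr (fun j => (score_cdf (kappa j) (kappa j))%:E)).
  by rewrite prodEFin big_enum.
by move=> j _; exact: score_law_eq0.
Qed.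

Lemma game_score_law (d d' : measure_display) (T : measurableType d)
    (T' : measurableType d') (R : realType) (P : probability T R)
    (Z : nat -> {RV P >-> R}) (P' : probability T' R) (n : nat)
    (S : 'I_n -> R -> {RV P' >-> R}) (i : 'I_n) (tau : R) :
  mutually_independent Z -> (forall k, uniform01 (Z k)) ->
  is_game_scores Z S -> threshold tau -> score_law (S i tau) tau.
Proof.
move=> indZ uniZ [lawS _] tau01 B mB B0; by rewrite lawS// score_prob.
Qed.

Lemma game_winning_probability (d d' : measure_display) (T : measurableType d)
    (T' : measurableType d') (R : realType) (P : probability T R)
    (Z : nat -> {RV P >-> R}) (P' : probability T' R) (n : nat)
    (adv : 'I_n) (S : 'I_n -> R -> {RV P' >-> R}) (kappa : 'I_n -> R)
    (i : 'I_n) :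
  (1 < n)%N -> mutually_independent Z -> (forall k, uniform01 (Z k)) ->
  is_game_scores Z S -> (forall j, threshold (kappa j)) ->
  winning_probability S adv kappa i = (win_chance adv kappa i)%:E.
Proof.
move=> n1 indZ uniZ gameS kappa01.
apply: (prob_wins adv (X := fun j => S j (kappa j))) => //.
  by case: gameS => _; apply.
by move=> j; exact: (game_score_law j indZ uniZ gameS).
Qed.

Lemma game_expected_payoff (d d' : measure_display) (T : measurableType d)
    (T' : measurableType d') (R : realType) (P : probability T R)
    (Z : nat -> {RV P >-> R}) (P' : probability T' R) (n : nat)
    (adv : 'I_n) (S : 'I_n -> R -> {RV P' >-> R}) (kappa : 'I_n -> R)
    (i : 'I_n) :
  (1 < n)%N -> mutually_independent Z -> (forall k, uniform01 (Z k)) ->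
  is_game_scores Z S -> (forall j, threshold (kappa j)) ->
  expected_payoff S adv kappa i = (win_chance adv kappa i)%:E.
Proof.
move=> n1 indZ uniZ gameS kappa01.
rewrite -(game_winning_probability adv i n1 indZ uniZ gameS kappa01).
rewrite /winning_probability -expectation_indic; last first.
  exact: (measurable_wins adv (fun j => S j (kappa j))).
rewrite /expected_payoff; apply: f_equal; apply/funext => w.
rewrite /payoff indicE; congr (nat_of_bool _)%:R.
by apply/idP/idP => [?|]; [exact: mem_set|rewrite inE].
Qed.

(** * Optimality of the thresholds *)

Lemma score_cdf_ge (R : realType) (tau x : R) : tau <= x ->
  score_cdf tau x = 1 - expR tau * (1 - x).
Proof. by move=> taux; rewrite /score_cdf max_r. Qed.

Lemma score_cdf_le (R : realType) (tau x : R) : x <= tau ->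
  score_cdf tau x = score_cdf tau tau.
Proof. by move=> taux; rewrite /score_cdf max_l// maxxx. Qed.

Lemma score_cdf_homo (R : realType) (tau : R) :
  {homo score_cdf tau : x y / x <= y}.
Proof.
move=> x y xy; rewrite /score_cdf lerD2l lerN2 ler_wpM2l ?expR_ge0//.
by rewrite lerD2l lerN2 ge_max !le_max lexx xy orbT.
Qed.

(** Multiplication by [expR (- tau)] turns this into [1 - tau <= expR (- tau)]. *)
Lemma score_cdf_diag_ge0 (R : realType) (tau : R) : 0 <= score_cdf tau tau.
Proof.
rewrite score_cdf_ge// subr_ge0 -(@ler_pM2l _ (expR (- tau))) ?expR_gt0//.
by rewrite mulrA -expRD addNr expR0 mul1r mulr1 expR_ge1Dx.
Qed.

Lemma score_cdf_ge0 (R : realType) (tau x : R) : 0 <= score_cdf tau x.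
Proof.
have [taux|taux] := leP tau x.
  by apply: le_trans (score_cdf_diag_ge0 tau) _; exact: score_cdf_homo.
by rewrite score_cdf_le ?score_cdf_diag_ge0// ltW.
Qed.

Lemma Rintegral_itv_split (R : realType) (f : R -> R) (a b c : R) :
  continuous f -> a <= b <= c ->
  \int[lebesgue_measure]_(x in `[a, c]) f x =
  \int[lebesgue_measure]_(x in `[a, b]) f x +
  \int[lebesgue_measure]_(x in `[b, c]) f x.
Proof.
move=> cf /andP[ab bc]; apply/eqP; rewrite addrC -subr_eq; apply/eqP.
rewrite Rintegral_itvB ?bnd_simp//; last exact: integrable_continuous_itv.
rewrite Rintegral_itv_obnd_cbnd//.
apply: integrableS (integrable_continuous_itv b c cf) => //.
by apply: subset_itvr; rewrite bnd_simp.
Qed.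

(** These are the one-sided bounds required by [exp_mul_tail_max]. *)
Lemma Rintegral_homo_bounds (R : realType) (f : R -> R) (a b : R) :
  continuous f -> {homo f : x y / x <= y} -> a <= b ->
  (b - a) * f a <= \int[lebesgue_measure]_(x in `[a, b]) f x <= (b - a) * f b.
Proof.
move=> cf f_homo ab.
have cstE r : \int[lebesgue_measure]_(x in `[a, b]) (cst r x) = (b - a) * r.
  rewrite Rintegral_cst//= lebesgue_measure_itv /= lte_fin mulrC.
  by move: ab; rewrite le_eqVlt => /predU1P[->|->]; rewrite ?ltxx ?subrr.
have intf := integrable_continuous_itv a b cf.
have intcst r : lebesgue_measure.-integrable `[a, b] (EFin \o cst r).
  exact/integrable_continuous_itv/cst_continuous.
rewrite -!cstE; apply/andP; split; apply: le_Rintegral => // x /=;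
  by rewrite in_itv /= => /andP[ax xb]; exact: f_homo.
Qed.

Lemma Rintegral_deriv_poly (R : realType) (p : {poly R}) (f : R -> R) (a b : R) :
  a <= b -> (forall x, a <= x <= b -> f x = p^`().[x]) ->
  \int[lebesgue_measure]_(x in `[a, b]) f x = p.[b] - p.[a].
Proof. by move=> ab fE; rewrite /Rintegral (integral_deriv_poly ab fE). Qed.

(* [expR t * J t] has derivative [expR t * (J t - g t)] when [J' = - g]; the
   two one-sided bounds on [J] replace differentiability. *)
Lemma exp_mul_tail_max (R : realType) (g J : R -> R) (s t : R) :
  (forall x y, 0 <= x -> x <= y -> y <= 1 ->
     (y - x) * g x <= J x - J y <= (y - x) * g y) ->
  0 <= s <= 1 -> 0 <= t <= 1 -> J s = g s -> 0 <= J s ->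
  expR t * J t <= expR s * J s.
Proof.
move=> bounds /andP[s0 s1] /andP[t0 t1] Js Js0.
suff Jt : J t <= J s * (1 + (s - t)).
  rewrite (_ : expR s = expR t * expR (s - t)); last by rewrite -expRD subrKC.
  rewrite -mulrA ler_pM2l ?expR_gt0// (le_trans Jt)// mulrC.
  by rewrite ler_wpM2r// expR_ge1Dx.
have [ts|/ltW st] := leP t s.
  by have /andP[_] := bounds _ _ t0 ts s1; rewrite -Js; lra.
by have /andP[+ _] := bounds _ _ s0 st t1; rewrite -Js; lra.
Qed.

Lemma win_chance_adv (R : realType) (n : nat) (adv : 'I_n) (eps delta t : R) :
  win_chance adv (deviation (advantage_profile adv eps delta) adv t) adv =
  score_cdf t t * score_cdf eps eps ^+ (n - 1) +
  expR t * \int[lebesgue_measure]_(x in `[t, 1]) (score_cdf eps x ^+ (n - 1)).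
Proof.
have profE j : j != adv ->
    deviation (advantage_profile adv eps delta) adv t j = eps.
  by move=> /negbTE ja; rewrite /deviation /advantage_profile ja.
have card_others : #|[pred j | j != adv]| = (n - 1)%N.
  by have := cardC1 adv; rewrite card_ord -subn1.
have prodE x : \prod_(j | j != adv)
    score_cdf (deviation (advantage_profile adv eps delta) adv t j) x =
    score_cdf eps x ^+ (n - 1).
  rewrite (eq_bigr (fun=> score_cdf eps x)); last by move=> j /profE ->.
  by rewrite prodr_const card_others.
rewrite /win_chance eqxx (bigD1 adv)//= {1 2}/deviation eqxx.
rewrite (eq_bigr (fun=> score_cdf eps eps)); last by move=> j /profE ->.
rewrite prodr_const card_others [deviation _ _ _ adv]/deviation eqxx.
congr (_ + _ * _); rewrite /Rintegral; congr fine.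
by apply: eq_integral => x _; rewrite prodE.
Qed.

Lemma win_chance_other (R : realType) (n : nat) (adv i : 'I_n)
    (eps delta t : R) :
  i != adv ->
  win_chance adv (deviation (advantage_profile adv eps delta) i t) i =
  expR t * \int[lebesgue_measure]_(x in `[t, 1])
    (score_cdf delta x * score_cdf eps x ^+ (n - 2)).
Proof.
move=> ia; rewrite /win_chance (negbTE ia) add0r [deviation _ _ _ i]/deviation eqxx.
congr (_ * _); rewrite /Rintegral; congr fine; apply: eq_integral => x _.
rewrite (bigD1 adv) 1?eq_sym//= {1}/deviation {1}/advantage_profile.
rewrite eq_sym (negbTE ia) eqxx; congr (_ * _)%:E.
rewrite (eq_bigr (fun=> score_cdf eps x)); last first.
  move=> j /andP[/negbTE ji /negbTE ja].
  by rewrite /deviation /advantage_profile ji ja.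
rewrite prodr_const; congr (_ ^+ _).
have card_i := cardC1 i; rewrite card_ord (cardD1 adv) inE eq_sym ia in card_i.
rewrite (_ : (n - 2 = n.-1.-1)%N); last by rewrite -!subn1 -subnDA.
by rewrite -card_i add1n /=; apply: eq_card => j; rewrite !inE andbC.
Qed.

(** To the right of [tau] the function [score_cdf tau] is affine with slope [expR tau], so its
    powers have an explicit polynomial primitive. *)
Lemma integral_score_cdf_exp (R : realType) (tau a b : R) (k : nat) :
  tau <= a <= b ->
  \int[lebesgue_measure]_(x in `[a, b]) (score_cdf tau x ^+ k) =
  (score_cdf tau b ^+ k.+1 - score_cdf tau a ^+ k.+1) / (k.+1%:R * expR tau).
Proof.
move=> /andP[taua ab].
pose q : {poly R} := (1 - expR tau)%:P + expR tau *: 'X.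
have qE x : tau <= x -> q.[x] = score_cdf tau x.
  move=> taux; rewrite score_cdf_ge// /q hornerD hornerC hornerZ hornerX.
  by ring.
have e0 : expR tau != 0 by rewrite gt_eqF ?expR_gt0.
have k0 : k.+1%:R != 0 :> R by rewrite pnatr_eq0.
pose p := (k.+1%:R * expR tau)^-1 *: q ^+ k.+1.
rewrite (Rintegral_deriv_poly (p := p))//; last first.
  move=> x /andP[ax _].
  rewrite -qE ?(le_trans taua)// /p derivZ deriv_exp succnK /q derivD derivC.
  rewrite derivZ derivX add0r -/q hornerZ hornerMn hornerM horner_exp.
  rewrite alg_polyC hornerC -[(expR _ * _) *+ _]mulr_natr.
  move: k0; move: (k.+1%:R : R) (q.[x] ^+ k) => K y k0; field.
  by rewrite e0 k0.
rewrite /p !hornerZ !horner_exp !qE// ?(le_trans taua)//.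
by rewrite mulrBl ![_^-1 * _]mulrC.
Qed.

(** Through the trivial deviation, the payoff of the profile itself becomes an instance of the
    deviation formulas. *)
Lemma deviation_self (R : realType) (n : nat) (kappa : 'I_n -> R) (i : 'I_n) :
  deviation kappa i (kappa i) = kappa.
Proof. by apply/funext => j; rewrite /deviation; case: eqP => [->|]. Qed.

Lemma score_cdf_at1 (R : realType) (tau : R) : tau <= 1 -> score_cdf tau 1 = 1.
Proof. by move=> tau1; rewrite score_cdf_ge// subrr mulr0 subr0. Qed.

Lemma continuous_exp_score_cdf (R : realType) (tau : R) (k : nat) :
  continuous (fun x => score_cdf tau x ^+ k).
Proof.
move=> x; apply: (@continuous_comp _ _ _ (score_cdf tau) (fun y => y ^+ k)).
  exact: continuous_score_cdf.
exact: exprn_continuous.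
Qed.

Lemma win_chance_profile_adv (R : realType) (n : nat) (adv : 'I_n)
    (eps delta : R) :
  (0 < n)%N -> eps <= delta <= 1 ->
  win_chance adv (advantage_profile adv eps delta) adv =
  score_cdf delta delta * score_cdf eps eps ^+ (n - 1) +
  expR delta * ((1 - score_cdf eps delta ^+ n) / (n%:R * expR eps)).
Proof.
move=> n0 /andP[ed d1].
have := win_chance_adv adv eps delta delta.
rewrite (_ : deviation _ _ _ = advantage_profile adv eps delta); last first.
  by rewrite -[RHS](deviation_self _ adv) {3}/advantage_profile eqxx.
move=> ->; rewrite integral_score_cdf_exp ?ed//.
by rewrite subn1 prednK// score_cdf_at1 ?expr1n// (le_trans ed).
Qed.

(** The last hypothesis says that the tail integral of [g - A] at [delta] equals [g delta - A], the
    stationarity condition of [exp_mul_tail_max]. *)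
Lemma adv_threshold_optimal (R : realType) (n : nat) (adv : 'I_n)
    (eps delta t : R) :
  (0 < n)%N -> 0 <= eps -> eps <= delta <= 1 -> 0 <= t <= 1 ->
  score_cdf eps eps ^+ (n - 1) * delta =
    score_cdf eps delta ^+ (n - 1) -
    (1 - score_cdf eps delta ^+ n) / (n%:R * expR eps) ->
  win_chance adv (deviation (advantage_profile adv eps delta) adv t) adv <=
  win_chance adv (advantage_profile adv eps delta) adv.
Proof.
move=> n0 e0 ed1 t01 sysE; have /andP[ed d1] := ed1.
rewrite win_chance_profile_adv// win_chance_adv.
set A := score_cdf eps eps ^+ (n - 1) in sysE *.
pose g x := score_cdf eps x ^+ (n - 1).
pose I t := \int[lebesgue_measure]_(x in `[t, 1]) g x.
have gE x : g x = score_cdf eps x ^+ (n - 1) by [].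
have cg : continuous g by exact: continuous_exp_score_cdf.
have g_homo : {homo g : x y / x <= y}.
  by move=> x y xy; rewrite /g lerXn2r ?nnegrE ?score_cdf_ge0//; exact: score_cdf_homo.
have Idelta : I delta = (1 - score_cdf eps delta ^+ n) / (n%:R * expR eps).
  rewrite /I integral_score_cdf_exp ?ed// subn1 prednK//.
  by rewrite score_cdf_at1 ?expr1n// (le_trans ed).
(* The gain from all scores being 0 amounts to a constant [A] and the subtraction of [A] from the
   integrand. *)
have winE x : score_cdf x x * A + expR x * I x = A + expR x * (I x - A * (1 - x)).
  by rewrite score_cdf_ge//; ring.
rewrite -/(I t) -Idelta !winE lerD2l.
apply: (exp_mul_tail_max (g := fun x => g x - A) (J := fun x => I x - A * (1 - x))) => //.
- move=> x y x0 xy y1; have := Rintegral_homo_bounds cg g_homo xy.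
  rewrite /I (Rintegral_itv_split (a := x) (b := y) (c := 1) cg) ?xy//.
  by move=> /andP[lb ub]; apply/andP; split; lra.
- by rewrite (le_trans e0 ed).
- by rewrite Idelta gE; lra.
- have : A <= g delta by rewrite /A -gE; exact: g_homo.
  by rewrite Idelta gE; lra.
Qed.

(** By [exp_mul_tail_max] it is enough that the tail integral at [eps] equals the integrand there.
    The integral is split at [delta], where the distribution function of the player with advantage
    stops being constant. *)
Lemma other_threshold_optimal (R : realType) (n : nat) (adv i : 'I_n)
    (eps delta t : R) :
  (1 < n)%N -> i != adv -> 0 <= eps -> eps <= delta <= 1 -> 0 <= t <= 1 ->
  score_cdf eps eps ^+ (n - 2) *
    (n%:R * score_cdf delta delta * (score_cdf eps eps + (n%:R - 1) * expR eps)) =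
    expR (delta - eps) * (score_cdf eps delta ^+ n - 1) + n%:R ->
  win_chance adv (deviation (advantage_profile adv eps delta) i t) i <=
  win_chance adv (advantage_profile adv eps delta) i.
Proof.
move=> n1 ia e0 ed1 t01 sysE; have /andP[ed d1] := ed1.
have e1 : eps <= 1 by exact: le_trans ed d1.
rewrite -[in leRHS](deviation_self (advantage_profile adv eps delta) i).
rewrite {3}/advantage_profile (negbTE ia) !win_chance_other//.
pose F x := score_cdf eps x ^+ (n - 2).
pose g x := score_cdf delta x * F x.
pose I t := \int[lebesgue_measure]_(x in `[t, 1]) g x.
have F_ge0 x : 0 <= F x by rewrite exprn_ge0// score_cdf_ge0.
have cF : continuous F by exact: continuous_exp_score_cdf.
have cg : continuous g.
  by move=> x; apply: cvgM; [exact: continuous_score_cdf|exact: cF].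
have g_homo : {homo g : x y / x <= y}.
  move=> x y xy; rewrite /g ler_pM ?score_cdf_ge0//; first exact: score_cdf_homo.
  by rewrite /F lerXn2r ?nnegrE ?score_cdf_ge0//; exact: score_cdf_homo.
suff Ieps : I eps = g eps.
  rewrite -/(I t) -/(I eps); apply: (exp_mul_tail_max (g := g)) => //.
  - move=> x y x0 xy y1; have := Rintegral_homo_bounds cg g_homo xy.
    rewrite /I (Rintegral_itv_split (a := x) (b := y) (c := 1) cg) ?xy//.
    by move=> /andP[lb ub]; apply/andP; split; lra.
  - by rewrite e0.
  - by rewrite Ieps mulr_ge0// score_cdf_ge0.
have intF k a b : lebesgue_measure.-integrable `[a, b]
    (EFin \o (fun x => score_cdf eps x ^+ k)).
  exact/integrable_continuous_itv/continuous_exp_score_cdf.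
(* The ratio of the two score densities: above [delta], [score_cdf delta] is [1 - c] plus [c] times
   [score_cdf eps]. *)
pose c := expR (delta - eps).
have cE : expR delta = c * expR eps by rewrite -expRD subrK.
rewrite /I (Rintegral_itv_split (a := eps) (b := delta) (c := 1) cg) ?ed//.
have -> : \int[lebesgue_measure]_(x in `[eps, delta]) g x =
    \int[lebesgue_measure]_(x in `[eps, delta]) (score_cdf delta delta * F x).
  apply: eq_Rintegral => x; rewrite inE /= in_itv /= => /andP[_ xd].
  by rewrite /g score_cdf_le.
have -> : \int[lebesgue_measure]_(x in `[delta, 1]) g x =
    \int[lebesgue_measure]_(x in `[delta, 1])
      ((1 - c) * F x + c * score_cdf eps x ^+ (n - 1)).
  apply: eq_Rintegral => x; rewrite inE /= in_itv /= => /andP[dx _].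
  rewrite /g /F (_ : (n - 1 = (n - 2).+1)%N); last by rewrite -subSn.
  rewrite exprS (score_cdf_ge dx) (score_cdf_ge (le_trans ed dx)) cE.
  by ring.
have intcF r k a b : lebesgue_measure.-integrable `[a, b]
    (EFin \o (fun x => r * score_cdf eps x ^+ k)).
  apply: integrable_continuous_itv => x; apply: cvgMr.
  exact: continuous_exp_score_cdf.
rewrite RintegralD; [|by []|exact: intcF|exact: intcF].
rewrite !RintegralZl//; try exact: intF.
rewrite !integral_score_cdf_exp ?ed ?lexx// score_cdf_at1// !expr1n.
rewrite /g /F (score_cdf_le ed).
have bE : score_cdf delta delta = 1 - c * (1 - score_cdf eps delta).
  by rewrite (score_cdf_ge ed) (score_cdf_ge (lexx delta)) cE; ring.
rewrite -/c bE in sysE *.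
move: n1 sysE.
case: n {adv i ia F g I F_ge0 cF cg g_homo intF intcF} => [|[|m]] // _.
rewrite !subSS !subn0; set a := score_cdf eps eps; set W := score_cdf eps delta.
rewrite !exprS; have E0 : expR eps != 0 by rewrite gt_eqF ?expR_gt0.
have N1 : m.+1%:R != 0 :> R by rewrite pnatr_eq0.
have N2 : m.+2%:R != 0 :> R by rewrite pnatr_eq0.
have N2E : m.+2%:R = m.+1%:R + 1 :> R by rewrite -natr1.
rewrite N2E in N2 *; move: N1 N2.
move: (m.+1%:R : R) (a ^+ m) (W ^+ m) (expR eps) E0 => N am Wm E E0 N1 N2 sysE.
apply/eqP; rewrite -subr_eq0; apply/eqP.
(* Here [N] is [n - 1]. The difference to be shown zero is the difference of the two sides of
   [sysE], divided by [(N + 1) * N * E]. *)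
transitivity ((c * (W * (W * Wm) - 1) + (N + 1) -
   am * ((N + 1) * (1 - c * (1 - W)) * (a + (N + 1 - 1) * E))) / ((N + 1) * N * E)).
  by field; rewrite E0 N1 N2.
by rewrite sysE subrr mul0r.
Qed.

(** * Existence of the thresholds *)

Lemma score_cdf_diag_gt0 (R : realType) (tau : R) : tau != 0 ->
  0 < score_cdf tau tau.
Proof.
move=> tau0; rewrite score_cdf_ge// subr_gt0 -(@ltr_pM2l _ (expR (- tau))) ?expR_gt0//.
by rewrite mulrA -expRD addNr expR0 mul1r mulr1 expR_gt1Dx// oppr_eq0.
Qed.

(** The expressions of the system are values of [score_cdf], and denominators are cleared. They do
    not vanish because [y] is positive, which makes [score_cdf y y] positive. *)
Lemma threshold_systemP (R : realType) (n : nat) (x y : R) :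
  (1 < n)%N -> 0 <= x -> x < y ->
  threshold_system n x y <->
  score_cdf x x ^+ (n - 2) *
    (n%:R * score_cdf y y * (score_cdf x x + (n%:R - 1) * expR x)) =
    expR (y - x) * (score_cdf x y ^+ n - 1) + n%:R /\
  score_cdf x x ^+ (n - 1) * y =
    score_cdf x y ^+ (n - 1) - (1 - score_cdf x y ^+ n) / (n%:R * expR x).
Proof.
move=> n1 x0 xy; have y0 : 0 < y by exact: le_lt_trans xy.
have b0 : 0 < score_cdf y y by rewrite score_cdf_diag_gt0// gt_eqF.
have aE : 1 + expR x * (-1 + x) = score_cdf x x by rewrite score_cdf_ge//; ring.
have bE : 1 + expR y * (-1 + y) = score_cdf y y by rewrite score_cdf_ge//; ring.
have WE : 1 + expR x * (-1 + y) = score_cdf x y.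
  by rewrite score_cdf_ge ?(ltW xy)//; ring.
have WE' : 1 + expR x * (y - 1) = score_cdf x y.
  by rewrite score_cdf_ge ?(ltW xy)//; ring.
have sumE : 1 + expR x * (-2 + n%:R + x) =
    score_cdf x x + (n%:R - 1) * expR x by rewrite -aE; ring.
rewrite /threshold_system aE bE WE WE' sumE expRN.
have a0 := score_cdf_diag_ge0 x.
have E0 : 0 < expR x by exact: expR_gt0.
have eyE : expR y = expR (y - x) * expR x by rewrite -expRD subrK.
have N1 : 1 <= n%:R - 1 :> R.
  by rewrite lerBrDr -[leLHS]/(2%:R) ler_nat.
have s0 : 0 < score_cdf x x + (n%:R - 1) * expR x.
  by apply: ltr_wpDl => //; apply: mulr_gt0 => //; apply: lt_le_trans N1.
rewrite eyE.
move: (n%:R : R) N1 s0 (score_cdf x x ^+ (n - 2)) (score_cdf x x ^+ (n - 1))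
  (score_cdf x y ^+ n) (score_cdf x y ^+ (n - 1)) (expR (y - x)) => N N1 s0 a2 a1 W W1 c.
move: (score_cdf y y) b0 (expR x) E0 s0 => b b0 E E0 s0.
move: (score_cdf x x + (N - 1) * E) s0 => s s0.
have N0 : N != 0 by rewrite gt_eqF//; lra.
have [b0' E0' s0' y0'] : [/\ b != 0, E != 0, s != 0 & y != 0].
  by split; rewrite gt_eqF.
split=> -[e1 e2]; split.
- by rewrite e1; field; rewrite ?N0 ?E0' ?b0' ?s0'.
- by rewrite e2; field; rewrite ?N0 ?E0' ?y0'.
- rewrite (_ : c * E * (-1 + W) + N * E = E * (c * (W - 1) + N)); last by ring.
  by rewrite -e1; field; rewrite ?N0 ?E0' ?b0' ?s0'.
- apply: (mulIf y0'); rewrite e2; field.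
  by rewrite N0 E0' y0'.
Qed.

(** Convexity of the power function: its graph lies above the tangent at [u]. *)
Lemma exprn_tangent (R : realFieldType) (n : nat) (u v : R) : 0 <= u -> u <= v ->
  n.+1%:R * u ^+ n * (v - u) <= v ^+ n.+1 - u ^+ n.+1.
Proof.
move=> u0 uv; elim: n => [|n IH]; first by rewrite expr0 !expr1 !mul1r.
have -> : v ^+ n.+2 - u ^+ n.+2 =
    v * (v ^+ n.+1 - u ^+ n.+1) + u ^+ n.+1 * (v - u).
  by rewrite [v ^+ n.+2]exprS [u ^+ n.+2]exprS; ring.
have -> : n.+2%:R * u ^+ n.+1 * (v - u) =
    u * (n.+1%:R * u ^+ n * (v - u)) + u ^+ n.+1 * (v - u).
  by rewrite -[n.+2%:R]natr1 exprS; ring.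
rewrite lerD2r ler_pM// mulr_ge0 ?subr_ge0// mulr_ge0 ?exprn_ge0//.
Qed.

(** From exponent 2 on the convexity is strict; strictness comes from replacing the factor [v] by
    [u], so [u = 0] is allowed. *)
Lemma exprn_tangent_lt (R : realFieldType) (n : nat) (u v : R) :
  0 <= u -> u < v ->
  n.+2%:R * u ^+ n.+1 * (v - u) < v ^+ n.+2 - u ^+ n.+2.
Proof.
move=> u0 uv; have v0 : 0 < v by exact: le_lt_trans uv.
have -> : v ^+ n.+2 - u ^+ n.+2 =
    v * (v ^+ n.+1 - u ^+ n.+1) + u ^+ n.+1 * (v - u).
  by rewrite [v ^+ n.+2]exprS [u ^+ n.+2]exprS; ring.
have -> : n.+2%:R * u ^+ n.+1 * (v - u) =
    u * (n.+1%:R * u ^+ n * (v - u)) + u ^+ n.+1 * (v - u).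
  by rewrite -[n.+2%:R]natr1 exprS; ring.
rewrite ltrD2r; apply: (@le_lt_trans _ _ (u * (v ^+ n.+1 - u ^+ n.+1))).
  by rewrite ler_wpM2l// exprn_tangent// ltW.
by rewrite ltr_pM2r// subr_gt0 ltrXn2r ?nnegrE// ltW.
Qed.

(** A form of the Bernoulli inequality. *)
Lemma onem_exprn_le (R : realFieldType) (n : nat) (y : R) : 0 <= y <= 1 ->
  1 - y ^+ n <= n%:R * (1 - y).
Proof.
move=> /andP[y0 y1]; elim: n => [|n IH]; first by rewrite expr0 subrr mul0r.
rewrite (_ : 1 - y ^+ n.+1 = (1 - y ^+ n) + y ^+ n * (1 - y)); last first.
  by rewrite exprS; ring.
rewrite -natr1 mulrDl mul1r lerD// ler_piMl ?subr_ge0//.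
exact: exprn_ile1.
Qed.

(* [expR (- y)] times the derivative at [y] of the winning probability of the
   player with advantage when all the others use the threshold [x]. *)
Definition adv_gap (R : realType) (n : nat) (x y : R) : R :=
  score_cdf x x ^+ (n - 1) * y + (1 - score_cdf x y ^+ n) / (n%:R * expR x) -
  score_cdf x y ^+ (n - 1).

(* [n (n - 1)] times the derivative at [t = x] of the winning probability of a
   player with threshold [t] whose opponents use [x], and [y] with advantage. *)
Definition other_gap (R : realType) (n : nat) (x y : R) : R :=
  expR (y - x) * (score_cdf x y ^+ n - 1) + n%:R -
  score_cdf x x ^+ (n - 2) *
    (n%:R * score_cdf y y * (score_cdf x x + (n%:R - 1) * expR x)).

(** Joint continuity is phrased with an arbitrary filter, so that either argument may be held fixed
    or both may move along a curve. *)
Lemma score_cdf_cvg (R : realType) (T : Type) (F : set_system T)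
    (f g : T -> R) (x y : R) : Filter F ->
  f @ F --> x -> g @ F --> y ->
  score_cdf (f t) (g t) @[t --> F] --> score_cdf x y.
Proof.
move=> FF fx gy; rewrite /score_cdf; apply: cvgB; first exact: cvg_cst.
apply: cvgM; first exact: (@continuous_cvg _ _ _ F FF f expR x (@continuous_expR R x) fx).
apply: cvgB; first exact: cvg_cst.
apply: (cvg_comp2 fx gy).
by apply: (@continuous_max R (R * R)%type fst snd (x, y)); [exact: cvg_fst|exact: cvg_snd].
Qed.

Lemma cvg_exprn_comp (R : realType) (T : Type) (F : set_system T)
    (f : T -> R) (x : R) (k : nat) : Filter F ->
  f @ F --> x -> f t ^+ k @[t --> F] --> x ^+ k.
Proof.
move=> FF fx.
exact: (@continuous_cvg _ _ _ F FF f (fun y => y ^+ k) x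
  (@exprn_continuous R k x) fx).
Qed.

Lemma adv_gap_cvg (R : realType) (n : nat) (T : Type) (F : set_system T)
    (f g : T -> R) (x y : R) : (0 < n)%N -> Filter F ->
  f @ F --> x -> g @ F --> y ->
  adv_gap n (f t) (g t) @[t --> F] --> adv_gap n x y.
Proof.
move=> n0 FF fx gy; rewrite /adv_gap.
have cxx := cvg_exprn_comp (k := (n - 1)%N) FF (score_cdf_cvg FF fx fx).
have cxy k := cvg_exprn_comp (k := k) FF (score_cdf_cvg FF fx gy).
apply: cvgB => //; apply: cvgD; first exact: cvgM.
apply: cvgM; first by apply: cvgB => //; exact: cvg_cst.
apply: cvgV; first by rewrite gt_eqF// mulr_gt0 ?ltr0n ?expR_gt0.
apply: cvgM; first exact: cvg_cst.
exact: (@continuous_cvg _ _ _ F FF f expR x (@continuous_expR R x) fx).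
Qed.

Lemma other_gap_cvg (R : realType) (n : nat) (T : Type) (F : set_system T)
    (f g : T -> R) (x y : R) : Filter F ->
  f @ F --> x -> g @ F --> y ->
  other_gap n (f t) (g t) @[t --> F] --> other_gap n x y.
Proof.
move=> FF fx gy; rewrite /other_gap.
have cxx := score_cdf_cvg FF fx fx.
have cyy := score_cdf_cvg FF gy gy.
have cxy := cvg_exprn_comp (k := n) FF (score_cdf_cvg FF fx gy).
have cexp (h : T -> R) (z : R) : h @ F --> z -> expR (h t) @[t --> F] --> expR z.
  by move=> hz; exact: (@continuous_cvg _ _ _ F FF h expR z (@continuous_expR R z) hz).
apply: cvgB.
  apply: cvgD; last exact: cvg_cst.
  apply: cvgM; last by apply: cvgB => //; exact: cvg_cst.
  by apply: cexp; exact: cvgB.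
apply: cvgM; first exact: cvg_exprn_comp.
apply: cvgM; first by apply: cvgM => //; exact: cvg_cst.
apply: cvgD => //; apply: cvgM; last exact: cexp.
exact: cvg_cst.
Qed.

(** The first two terms have slope [score_cdf x x ^+ (n - 1) - score_cdf x y ^+ (n - 1)] in [y],
    which is at most 0 for [y >= x]; the tangent inequality expresses this without derivatives. The
    last term decreases strictly. *)
Lemma adv_gap_decr (R : realType) (n : nat) (x y z : R) : (1 < n)%N ->
  x <= y -> y < z -> adv_gap n x z < adv_gap n x y.
Proof.
case: n => [|[|n]] // _ xy yz; rewrite /adv_gap !subSS subn0.
have xz : x <= z by exact: le_trans (ltW yz).
set A := score_cdf x x; set u := score_cdf x y; set v := score_cdf x z.
have E0 : 0 < expR x by exact: expR_gt0.
have uv : v - u = expR x * (z - y) by rewrite /u /v !score_cdf_ge//; ring.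
have u0 : 0 <= u by exact: score_cdf_ge0.
have ltuv : u < v by rewrite -subr_gt0 uv mulr_gt0// subr_gt0.
have Au : A ^+ n.+1 <= u ^+ n.+1.
  rewrite lerXn2r ?nnegrE ?score_cdf_ge0//; exact: score_cdf_homo.
have tangent := exprn_tangent n.+1 u0 (ltW ltuv).
have pow_lt : u ^+ n.+1 < v ^+ n.+1 by rewrite ltrXn2r ?nnegrE// (le_trans u0 (ltW ltuv)).
have N0 : 0 < n.+2%:R :> R by rewrite ltr0n.
have slope : A ^+ n.+1 * (z - y) <=
    (1 - u ^+ n.+2) / (n.+2%:R * expR x) - (1 - v ^+ n.+2) / (n.+2%:R * expR x).
  rewrite -mulrBl ler_pdivlMr ?mulr_gt0//.
  rewrite (_ : 1 - _ - _ = v ^+ n.+2 - u ^+ n.+2); last by ring.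
  apply: le_trans tangent; rewrite uv.
  rewrite (_ : n.+2%:R * _ * _ = u ^+ n.+1 * (z - y) * (n.+2%:R * expR x)); last by ring.
  by rewrite ler_pM2r ?mulr_gt0// ler_wpM2r// subr_ge0 ltW.
move: slope pow_lt; rewrite mulrBr.
move: ((1 - u ^+ _) / _) => qu; move: ((1 - v ^+ _) / _) => qv.
by move: (A ^+ _ * z) (A ^+ _ * y) => Az Ay; lra.
Qed.

Lemma score_cdf_diag_lt1 (R : realType) (x : R) : x < 1 -> score_cdf x x < 1.
Proof. by move=> x1; rewrite score_cdf_ge// gtrBl mulr_gt0 ?expR_gt0 ?subr_gt0. Qed.

(** On the diagonal the gap is the integral over [[x, 1]] of the increase of
    [score_cdf x ^+ (n - 1)] from its value at [x]. Its positivity is the strict tangent inequality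
    between [A] and 1. *)
Lemma adv_gap_diag_gt0 (R : realType) (n : nat) (x : R) : (1 < n)%N ->
  x < 1 -> 0 < adv_gap n x x.
Proof.
case: n => [|[|n]] // _ x1; rewrite /adv_gap !subSS subn0.
set A := score_cdf x x.
have A1 : 1 - A = expR x * (1 - x) by rewrite /A score_cdf_ge//; ring.
have := exprn_tangent_lt n (score_cdf_diag_ge0 x) (score_cdf_diag_lt1 x1).
rewrite -/A expr1n A1 => tangent.
have N0 : 0 < n.+2%:R :> R by rewrite ltr0n.
have E0 : 0 < expR x by exact: expR_gt0.
have : A ^+ n.+1 * (1 - x) < (1 - A ^+ n.+2) / (n.+2%:R * expR x).
  rewrite ltr_pdivlMr ?mulr_gt0//; apply: le_lt_trans tangent.
  by rewrite le_eqVlt; apply/orP; left; apply/eqP; ring.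
rewrite mulrBr mulr1; move: ((1 - A ^+ _) / _) => q.
by move: (A ^+ _) (A ^+ _ * x) => An Ax; lra.
Qed.

Lemma adv_gap1_lt0 (R : realType) (n : nat) (x : R) : (1 < n)%N ->
  x < 1 -> adv_gap n x 1 < 0.
Proof.
move=> n1 x1; rewrite /adv_gap score_cdf_at1 ?(ltW x1)// !expr1n subrr mul0r.
rewrite mulr1 addr0 subr_lt0 exprn_ilt1 ?score_cdf_diag_ge0//.
  by rewrite -lt0n subn_gt0.
exact: score_cdf_diag_lt1.
Qed.

Lemma adv_gap_root (R : realType) (n : nat) (x : R) : (1 < n)%N ->
  x < 1 -> exists2 y, x < y < 1 & adv_gap n x y = 0.
Proof.
move=> n1 x1; have n0 := ltnW n1.
have cgap : {within `[x, 1], continuous (adv_gap n x)}.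
  apply: continuous_subspaceT => y.
  by apply: (adv_gap_cvg (f := cst x) n0); [exact: cvg_cst|exact: cvg_id].
have gx := adv_gap_diag_gt0 n1 x1; have g1 := adv_gap1_lt0 n1 x1.
have [|y] := IVT (v := 0) (ltW x1) cgap.
  by rewrite ge_min le_max (ltW gx) (ltW g1) orbT.
rewrite in_itv /= => /andP[xy y1] gy; exists y => //.
rewrite !lt_neqAle xy y1 !andbT; apply/andP; split; apply/eqP => yE.
  by move: gy gx; rewrite -yE => ->; rewrite ltxx.
by move: gy g1; rewrite yE => ->; rewrite ltxx.
Qed.

(** For [x0 < 1], the gap has opposite signs at points on either side of [D x0]. These signs persist
    for [t] near [x0], and monotonicity traps [D t] between the points. From 1 on, [t < D t < 1]
    squeezes the values at [t < 1]. *)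
Lemma adv_response_continuous (R : realType) (n : nat) (D : R -> R) :
  (1 < n)%N ->
  (forall x, x < 1 -> x < D x < 1 /\ adv_gap n x (D x) = 0) ->
  (forall x, 1 <= x -> D x = 1) ->
  continuous D.
Proof.
move=> n1 D_lt1 D_ge1 x0; have n0 := ltnW n1.
apply/cvgrPdist_lt => e e0; have [x01|x01] := ltP x0 1; last first.
  near=> t.
  have : `|x0 - t| < e by near: t; exact: (nbhsx_ballx x0 e e0).
  rewrite !ltr_norml (D_ge1 x0 x01).
  have [t1|t1] := ltP t 1; last by rewrite (D_ge1 t t1); lra.
  by have [/andP[tD D1] _] := D_lt1 t t1; lra.
have [/andP[xD D1] gapD] := D_lt1 x0 x01.
(* The points [y1] and [y2] enclose [D x0], lie within [e] of it and stay in []x0, 1[], where the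
   gap is monotone. *)
pose y1 := Num.max (D x0 - e / 2) ((x0 + D x0) / 2).
pose y2 := Num.min (D x0 + e / 2) ((D x0 + 1) / 2).
have xy1 : x0 < y1 by rewrite lt_max; apply/orP; right; lra.
have y1D : y1 < D x0 by rewrite gt_max; apply/andP; split; lra.
have Dy2 : D x0 < y2 by rewrite lt_min; apply/andP; split; lra.
have y21 : y2 < 1 by rewrite gt_min; apply/orP; right; lra.
have y1e : D x0 - e < y1 by rewrite lt_max; apply/orP; left; lra.
have y2e : y2 < D x0 + e by rewrite gt_min; apply/orP; left; lra.
have gap_cvg y : adv_gap n t y @[t --> x0] --> adv_gap n x0 y.
  by apply: (adv_gap_cvg (g := cst y) n0); [exact: cvg_id|exact: cvg_cst].
have gap1 : 0 < adv_gap n x0 y1.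
  by rewrite -gapD; apply: adv_gap_decr => //; exact: ltW.
have gap2 : adv_gap n x0 y2 < 0.
  by rewrite -gapD; apply: adv_gap_decr => //; exact: ltW.
near=> t.
have ty1 : t < y1 by near: t; exact: lt_nbhsl.
have tgap1 : 0 < adv_gap n t y1 by near: t; exact: (cvgr_gt _ (gap_cvg y1)).
have tgap2 : adv_gap n t y2 < 0 by near: t; exact: (cvgr_lt _ (gap_cvg y2)).
have t1 : t < 1 by lra.
have [/andP[tD _] tgap] := D_lt1 t t1.
have y1Dt : y1 < D t.
  rewrite ltNge le_eqVlt; apply/negP => /predU1P[E|Dty1].
    by move: tgap1; rewrite -E tgap ltxx.
  by have := adv_gap_decr n1 (ltW tD) Dty1; rewrite tgap; lra.
have Dty2 : D t < y2.
  rewrite ltNge le_eqVlt; apply/negP => /predU1P[E|y2Dt].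
    by move: tgap2; rewrite E tgap ltxx.
  have ty2 : t <= y2 by lra.
  by have := adv_gap_decr n1 ty2 y2Dt; rewrite tgap; lra.
by rewrite ltr_norml; apply/andP; split; lra.
Unshelve. all: by end_near. Qed.

(** As [score_cdf 0 0 = 0], the power with exponent [n - 2] vanishes unless [n = 2]. In that case
    the gap is [expR y * (1 - y) ^+ 2]; otherwise the Bernoulli inequality and
    [expR y * (1 - y) < 1] give the sign. *)
Lemma other_gap0_gt0 (R : realType) (n : nat) (y : R) : (1 < n)%N ->
  0 < y < 1 -> 0 < other_gap n 0 y.
Proof.
move=> n1 /andP[y0 y1]; rewrite /other_gap subr0.
have -> : score_cdf 0 0 = 0 :> R.
  by rewrite score_cdf_ge// expR0 subr0 mul1r subrr.
have -> : score_cdf 0 y = y by rewrite score_cdf_ge ?(ltW y0)// expR0; ring.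
rewrite (score_cdf_ge (lexx y)) expR0 add0r mulr1.
have ey0 : 0 < expR y by exact: expR_gt0.
case: n n1 => [|[|[|n]]] // _.
  rewrite expr0 (_ : _ - _ = expR y * (1 - y) ^+ 2); last by ring.
  by rewrite mulr_gt0// exprn_gt0// subr_gt0.
rewrite subSS subSS subn0 expr0n /= mul0r subr0.
have := score_cdf_diag_gt0 (negbT (gt_eqF y0)).
rewrite score_cdf_ge// subr_gt0 => ey1.
have := onem_exprn_le n.+3 (y := y); rewrite (ltW y0) (ltW y1) => /(_ isT).
move=> bern; have N0 : 0 < n.+3%:R :> R by rewrite ltr0n.
have : expR y * (1 - y ^+ n.+3) < n.+3%:R.
  apply: (@le_lt_trans _ _ (n.+3%:R * (expR y * (1 - y)))).
    by rewrite mulrCA ler_wpM2l// ltW.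
  by rewrite gtr_pMr.
by move: (y ^+ _) (expR y) => p ey; lra.
Qed.

Lemma other_gap11_lt0 (R : realType) (n : nat) : (1 < n)%N ->
  other_gap n (1 : R) 1 < 0.
Proof.
move=> n1; rewrite /other_gap score_cdf_at1// !expr1n subrr mulr0 add0r mul1r.
have N1 : 1 < n%:R :> R by rewrite ltr1n.
rewrite (_ : _ - _ = - (n%:R * ((n%:R - 1) * expR 1))); last by ring.
by rewrite oppr_lt0 !mulr_gt0 ?expR_gt0 ?subr_gt0// ltr0n ltnW.
Qed.

Lemma equilibrium_thresholds_exist (R : realType) (n : nat) : (1 < n)%N ->
  exists eps delta : R, equilibrium_thresholds n eps delta.
Proof.
move=> n1; have n0 := ltnW n1.
(* The value 1 from [x = 1] on extends the curve of roots continuously, so that the intermediate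
   value theorem applies on the closed interval [[0, 1]]. *)
pose Q (x y : R) :=
  (x < 1 -> x < y < 1 /\ adv_gap n x y = 0) /\ (1 <= x -> y = 1).
have /choice[D D_spec] : forall x, exists y, Q x y.
  move=> x; have [x1|x1] := ltP x 1.
    by have [y] := adv_gap_root n1 x1; exists y; split => //; rewrite leNgt x1.
  by exists 1; split => //; rewrite ltNge x1.
have D_lt1 x x1 := (D_spec x).1 x1; have D_ge1 x x1 := (D_spec x).2 x1.
have cD := adv_response_continuous n1 D_lt1 D_ge1.
have cgap : {within `[0, 1], continuous (fun x => other_gap n x (D x))}.
  apply: continuous_subspaceT => x.
  by apply: other_gap_cvg; [exact: cvg_id|exact: cD].
have [D01 _] := D_lt1 0 ltr01.
have gap0 := other_gap0_gt0 n1 D01.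
have gap1 : other_gap n 1 (D 1) < 0 by rewrite D_ge1//; exact: other_gap11_lt0.
have [|x] := IVT (v := 0) ler01 cgap.
  by rewrite ge_min le_max (ltW gap0) (ltW gap1) orbT.
rewrite in_itv /= => /andP[x0 x1] gapx.
(* At 1 the gap is negative, so the root lies where [x < D x] holds strictly. *)
have lt_x1 : x < 1.
  rewrite lt_neqAle x1 andbT; apply/eqP => xE.
  by move: gap1; rewrite -xE gapx ltxx.
have [/andP[xD DD1] Dgap] := D_lt1 x lt_x1.
exists x, (D x); split => //.
- by rewrite /threshold /= in_itv /= x0.
- by rewrite /threshold /= in_itv /= (ltW DD1) (le_trans x0 (ltW xD)).
- apply/threshold_systemP => //; split; first by move: gapx; rewrite /other_gap; lra.
  by move/eqP: Dgap; rewrite /adv_gap subr_eq0 => /eqP <-; rewrite addrK.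
Qed.

(** * The equilibrium and the winning probability of the player with advantage *)

Unset Implicit Arguments.

Theorem proposition7 (R : realType) (n : nat) (adv : 'I_n)
    (d : measure_display) (T : measurableType d) (P : probability T R)
    (Z : nat -> {RV P >-> R})
    (d' : measure_display) (T' : measurableType d') (P' : probability T' R)
    (S : 'I_n -> R -> {RV P' >-> R}) :
  (1 < n)%N ->
  mutually_independent Z ->
  (forall k, uniform01 (Z k)) ->
  is_game_scores Z S ->
  (exists eps delta : R, equilibrium_thresholds n eps delta) /\
  (forall eps delta : R, equilibrium_thresholds n eps delta ->
     nash_equilibrium (@threshold R) (expected_payoff S adv)
       (advantage_profile adv eps delta) /\
     winning_probability S adv (advantage_profile adv eps delta) adv =
     ((1 - expR eps + expR eps * eps) ^+ (n - 1) *
        (1 - expR delta + expR delta * delta) +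
      expR delta * (1 - (1 + expR eps * (-1 + delta)) ^+ n) /
        (expR eps * n%:R))%:E).
Proof.
move=> n1 indZ uniZ gameS; split; first exact: equilibrium_thresholds_exist.
move=> eps delta [eps01 delta01 ed].
have /andP[e0 e1] : 0 <= eps <= 1 by move: eps01; rewrite /threshold /= in_itv.
have /andP[d0 d1] : 0 <= delta <= 1 by move: delta01; rewrite /threshold /= in_itv.
have ed1 : eps <= delta <= 1 by rewrite (ltW ed).
(* The first equation is the stationarity condition of the players without advantage, the second
   that of the player with advantage. *)
move=> /threshold_systemP-/(_ n1 e0 ed)[other_eq adv_eq].
have profile01 i : threshold (advantage_profile adv eps delta i).
  by rewrite /advantage_profile; case: ifP.
split.
  split=> // i tau tau01.
  have deviation01 j : threshold (deviation (advantage_profile adv eps delta) i tau j).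
    by rewrite /deviation; case: ifP.
  rewrite !(game_expected_payoff adv i n1 indZ uniZ gameS)// lee_fin.
  have t01 : 0 <= tau <= 1 by move: tau01; rewrite /threshold /= in_itv.
  have [->|ia] := eqVneq i adv.
    exact: adv_threshold_optimal (ltnW n1) e0 ed1 t01 adv_eq.
  exact: other_threshold_optimal n1 ia e0 ed1 t01 other_eq.
rewrite (game_winning_probability adv adv n1 indZ uniZ gameS)//.
rewrite win_chance_profile_adv ?(ltnW n1)//.
rewrite !score_cdf_ge ?(ltW ed)//; congr _%:E.
rewrite (_ : 1 - expR eps * (1 - eps) = 1 - expR eps + expR eps * eps); last by ring.
rewrite (_ : 1 - expR eps * (1 - delta) = 1 + expR eps * (-1 + delta)); last by ring.
by rewrite [n%:R * _]mulrC mulrA [X in X + _]mulrC; congr (_ * _ + _); ring.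
Qed.
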